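(* For a two-player stage game $G$, we have $G\notin\mathcal{G}_{LS}^{m,p}$ and $G\in\mathcal{G}_{LS}^{m,m}$ if and only if one of the following holds: (1) $|V_1^{m,p}|=0$, $|V_2^{m,p}|=0$, and $\mathcal{C}^{m,m}(G)$ holds; (2) $|V_1^{m,p}|=1$, $|V_2^{m,p}|=1$, and $\mathcal{C}^{m,m}(G)$ holds; (3) $|V_1^{m,p}|>1$, $|V_2^{m,p}|=1$, $\mathcal{C}^{m,p}(G)$ does not hold, and $\mathcal{C}^{m,m}(G)$ holds; (4) $|V_1^{m,p}|=1$, $|V_2^{m,p}|>1$, $\mathcal{C}^{m,p}(G)$ does not hold, and $\mathcal{C}^{m,m}(G)$ holds.
   Context: A two-player stage game $G$ has finite nonempty action sets $A_1,A_2$ and payoffs $u_1,u_2:A_1\times A_2\to\mathbb{R}$, extended to mixed strategies by expectation; $S_{\sigma_1}$ is the support of $\sigma_1$; best response means maximizing expected payoff against the opponent's strategy. $G(T)$ is the $T$-round repetition with realized actions observed each round and payoffs the expected sum of stage payoffs; an SPE of $G(T)$ is a strategy profile whose continuation after every history of length $k<T$ is a Nash equilibrium of $G(T-k)$. Regimes: pure-pure ($p,p$): both players restricted to actions (in the stage game and in every round, including deviations); mixed-pure ($m,p$): player 1 may mix, player 2 uses only actions; mixed-mixed ($m,m$): both may mix. For regime $r$, $\mathrm{Nash}^r(G)$ is the set of stage-game profiles available in $r$ from which no player can profitably deviate unilaterally to a strategy available in $r$, and $V_i^r=\{u_i(\sigma):\sigma\in\mathrm{Nash}^r(G)\}$.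 Locally suboptimal behavior occurs in an SPE $\mu$ of $G(T)$ (regime $r$) if for some history $h$ of length $k<T$, $(\mu_1(h),\mu_2(h))\notin\mathrm{Nash}^r(G)$. $\mathcal{G}_{LS}^r$ is the set of stage games $G$ for which there exist $T\ge1$ and an SPE of $G(T)$ in regime $r$ in which locally suboptimal behavior occurs. Condition $\mathcal{C}^{m,p}(G)$ holds iff one of: (i) $|V_1^{m,p}|>1$, $|V_2^{m,p}|>1$, and some $(\hat\sigma_1,\hat a_2)\in\Delta A_1\times A_2$ is not in $\mathrm{Nash}^{m,p}(G)$; (ii) $|V_1^{m,p}|>1$, $|V_2^{m,p}|=1$, and there exist $\hat\sigma_1\in\Delta A_1$, $a_1'\in A_1$, $\hat a_2\in A_2$ with $u_1(\hat\sigma_1,\hat a_2)<u_1(a_1',\hat a_2)$, $\hat a_2$ a best response to $\hat\sigma_1$, and, if $|S_{\hat\sigma_1}|>1$, with $D=\{u_1(\sigma)-u_1(\sigma'):\sigma,\sigma'\in\mathrm{Nash}^{m,p}(G)\}$, some $a\in S_{\hat\sigma_1}$ such that for every $a'\in S_{\hat\sigma_1}\setminus\{a\}$ there are an integer $n\ge0$ and $d_1,\dots,d_n\in D$ with $u_1(a,\hat a_2)-u_1(a',\hat a_2)=\sum_{k=1}^n d_k$; (iii) $|V_1^{m,p}|=1$, $|V_2^{m,p}|>1$, and there exist $\hat\sigma_1\in\Delta A_1$, $\hat a_2,a_2'\in A_2$ with $u_2(\hat\sigma_1,\hat a_2)<u_2(\hat\sigma_1,a_2')$ and $\hat\sigma_1$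 a best response to $\hat a_2$. Condition $\mathcal{C}^{m,m}(G)$ holds iff one of: (i) $|V_1^{m,m}|>1$, $|V_2^{m,m}|>1$, and some $(\hat\sigma_1,\hat\sigma_2)\in\Delta A_1\times\Delta A_2$ is not in $\mathrm{Nash}^{m,m}(G)$; (ii) $|V_1^{m,m}|>1$, $|V_2^{m,m}|=1$, and there exist $\hat\sigma_1,\hat\sigma_2$, $a_1'\in A_1$ with $u_1(\hat\sigma_1,\hat\sigma_2)<u_1(a_1',\hat\sigma_2)$ and $\hat\sigma_2$ a best response to $\hat\sigma_1$; (iii) $|V_1^{m,m}|=1$, $|V_2^{m,m}|>1$, and there exist $\hat\sigma_1,\hat\sigma_2$, $a_2'\in A_2$ with $u_2(\hat\sigma_1,\hat\sigma_2)<u_2(\hat\sigma_1,a_2')$ and $\hat\sigma_1$ a best response to $\hat\sigma_2$. *)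

(* Defs.v *)
From HB Require Import structures.
From mathcomp Require Import all_boot all_order all_algebra.
From mathcomp Require Import reals.
Set Implicit Arguments. Unset Strict Implicit. Unset Printing Implicit Defensive.
Import Order.TTheory GRing.Theory Num.Theory.
Local Open Scope ring_scope.

Section Games.
Variables (R : realType) (A1 A2 : finType).

Definition is_dist (A : finType) (p : {ffun A -> R}) : Prop :=
  (forall a, 0 <= p a) /\ \sum_(a : A) p a = 1.

Definition pure (A : finType) (a : A) : {ffun A -> R} := [ffun b => (b == a)%:R].

Definition eu (u : A1 -> A2 -> R) (s1 : {ffun A1 -> R}) (s2 : {ffun A2 -> R}) : R :=
  \sum_(a1 : A1) \sum_(a2 : A2) s1 a1 * s2 a2 * u a1 a2.

Inductive regime := PP | MP | MM.
Definition mixes1 (r : regime) : bool := if r is PP then false else true.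
Definition mixes2 (r : regime) : bool := if r is MM then true else false.

Definition avail (A : finType) (m : bool) (p : {ffun A -> R}) : Prop :=
  if m then is_dist p else exists a : A, p = pure a.

Definition stageNash (r : regime) (u1 u2 : A1 -> A2 -> R)
    (s1 : {ffun A1 -> R}) (s2 : {ffun A2 -> R}) : Prop :=
  [/\ avail (mixes1 r) s1, avail (mixes2 r) s2,
      (forall t1, avail (mixes1 r) t1 -> eu u1 t1 s2 <= eu u1 s1 s2) &
      (forall t2, avail (mixes2 r) t2 -> eu u2 s1 t2 <= eu u2 s1 s2)].

Definition V1 r u1 u2 (x : R) : Prop :=
  exists s1 s2, stageNash r u1 u2 s1 s2 /\ x = eu u1 s1 s2.
Definition V2 r u1 u2 (x : R) : Prop :=
  exists s1 s2, stageNash r u1 u2 s1 s2 /\ x = eu u2 s1 s2.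

Definition card_is0 (V : R -> Prop) : Prop := forall x, ~ V x.
Definition card_is1 (V : R -> Prop) : Prop := exists x, V x /\ forall y, V y -> y = x.
Definition card_gt1 (V : R -> Prop) : Prop := exists x y, [/\ V x, V y & x <> y].

Definition history := seq (A1 * A2).
Definition strat (A : finType) := history -> {ffun A -> R}.

Definition availS (A : finType) (m : bool) (s : strat A) : Prop :=
  forall h, avail m (s h).

Fixpoint val (u : A1 -> A2 -> R) (s1 : strat A1) (s2 : strat A2) (n : nat)
    (h : history) : R :=
  match n with
  | 0 => 0
  | n'.+1 => \sum_(a1 : A1) \sum_(a2 : A2)
               (s1 h a1 * s2 h a2) * (u a1 a2 + val u s1 s2 n' (rcons h (a1, a2)))
  end.

Definition cont (A : finType) (h : history) (s : strat A) : strat A :=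
  fun h' => s (h ++ h').

Definition repNash (r : regime) (u1 u2 : A1 -> A2 -> R) (n : nat)
    (s1 : strat A1) (s2 : strat A2) : Prop :=
  [/\ availS (mixes1 r) s1, availS (mixes2 r) s2,
      (forall t1, availS (mixes1 r) t1 -> val u1 t1 s2 n [::] <= val u1 s1 s2 n [::]) &
      (forall t2, availS (mixes2 r) t2 -> val u2 s1 t2 n [::] <= val u2 s1 s2 n [::])].

Definition SPE (r : regime) (u1 u2 : A1 -> A2 -> R) (T : nat)
    (s1 : strat A1) (s2 : strat A2) : Prop :=
  [/\ availS (mixes1 r) s1, availS (mixes2 r) s2 &
      forall h : history, (size h < T)%N ->
        repNash r u1 u2 (T - size h) (cont h s1) (cont h s2)].

Definition locally_suboptimal (r : regime) (u1 u2 : A1 -> A2 -> R) (T : nat)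
    (s1 : strat A1) (s2 : strat A2) : Prop :=
  exists h : history, (size h < T)%N /\ ~ stageNash r u1 u2 (s1 h) (s2 h).

Definition in_GLS (r : regime) (u1 u2 : A1 -> A2 -> R) : Prop :=
  exists T : nat, (1 <= T)%N /\
    exists s1 s2, SPE r u1 u2 T s1 s2 /\ locally_suboptimal r u1 u2 T s1 s2.

Definition supp (A : finType) (p : {ffun A -> R}) := [pred a : A | 0 < p a].

Definition Dset (u1 u2 : A1 -> A2 -> R) (d : R) : Prop :=
  exists s1 s1' s2 s2', [/\ stageNash MP u1 u2 s1 s2, stageNash MP u1 u2 s1' s2'
                         & d = eu u1 s1 s2 - eu u1 s1' s2'].

Definition C_mp (u1 u2 : A1 -> A2 -> R) : Prop :=
  [\/ [/\ card_gt1 (V1 MP u1 u2), card_gt1 (V2 MP u1 u2) &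
        exists (s1 : {ffun A1 -> R}) (a2 : A2),
          is_dist s1 /\ ~ stageNash MP u1 u2 s1 (pure a2)],
      [/\ card_gt1 (V1 MP u1 u2), card_is1 (V2 MP u1 u2) &
        exists (s1 : {ffun A1 -> R}) (a1' : A1) (a2 : A2),
          [/\ is_dist s1,
              eu u1 s1 (pure a2) < eu u1 (pure a1') (pure a2),
              (forall b2 : A2, eu u2 s1 (pure b2) <= eu u2 s1 (pure a2)) &
              ((1 < #|supp s1|)%N ->
                 exists2 a : A1, a \in supp s1 &
                   forall a' : A1, a' \in supp s1 -> a' != a ->
                     exists ds : seq R, (forall d, d \in ds -> Dset u1 u2 d) /\
                       u1 a a2 - u1 a' a2 = \sum_(d <- ds) d)]] |
      [/\ card_is1 (V1 MP u1 u2), card_gt1 (V2 MP u1 u2) &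
        exists (s1 : {ffun A1 -> R}) (a2 a2' : A2),
          [/\ is_dist s1,
              eu u2 s1 (pure a2) < eu u2 s1 (pure a2') &
              (forall t1, is_dist t1 -> eu u1 t1 (pure a2) <= eu u1 s1 (pure a2))]]].

Definition C_mm (u1 u2 : A1 -> A2 -> R) : Prop :=
  [\/ [/\ card_gt1 (V1 MM u1 u2), card_gt1 (V2 MM u1 u2) &
        exists s1 s2, [/\ is_dist s1, is_dist s2 & ~ stageNash MM u1 u2 s1 s2]],
      [/\ card_gt1 (V1 MM u1 u2), card_is1 (V2 MM u1 u2) &
        exists s1 s2 (a1' : A1),
          [/\ is_dist s1, is_dist s2,
              eu u1 s1 s2 < eu u1 (pure a1') s2 &
              (forall t2, is_dist t2 -> eu u2 s1 t2 <= eu u2 s1 s2)]] |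
      [/\ card_is1 (V1 MM u1 u2), card_gt1 (V2 MM u1 u2) &
        exists s1 s2 (a2' : A2),
          [/\ is_dist s1, is_dist s2,
              eu u2 s1 s2 < eu u2 s1 (pure a2') &
              (forall t1, is_dist t1 -> eu u1 t1 s2 <= eu u1 s1 s2)]]].

End Games.

(* Main.v *)
Require Import Defs.
From HB Require Import structures.
From mathcomp Require Import all_boot all_order all_algebra.
From mathcomp Require Import boolp reals.
From mathcomp Require Import ring lra.
Import Order.TTheory GRing.Theory Num.Theory.
Local Open Scope ring_scope.

(** A one-shot-deviation principle turns subgame perfection into a recursion on
payoffs: locally suboptimal behaviour is possible iff some stage profile that is
not an equilibrium of [u] is an equilibrium of [u + w], where [w] assigns to each
outcome the payoffs of a subgame perfect equilibrium of a shorter game.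

Necessity looks at a last suboptimal history, after which only stage equilibria
are played; a player with a single equilibrium payoff must then be playing a stage
best reply. Sufficiency is reward and punishment, the delicate case being that of
a mixing player 1 who has to be made exactly indifferent by continuation payoffs.
In regime [MP] differences of equilibrium payoffs are stacked. In regime [MM], if
player 2 has the single equilibrium payoff [v], player 2 has two best replies
[b], [b'] to some strategy of player 1 supported by at most two actions (otherwise
one action of player 2 is strictly dominant and player 1 would also have a single
equilibrium payoff). Mixing [b] and [b'] serves as a lottery over continuations;
it yields an interval of payoffs of player 1, at constant payoff of player 2. *)

(** * Probability vectors and weighted averages *)

Section Mixtures.
Set Implicit Arguments.
Unset Strict Implicit.
Variables (R : realType) (A : finType).
Implicit Types (p : {ffun A -> R}) (f : A -> R).

Definition mix (q : R) p p' : {ffun A -> R} := [ffun a => q * p a + (1 - q) * p' a].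

Lemma is_dist_pure (a : A) : is_dist (pure R a).
Proof.
split=> [b|]; first by rewrite ffunE ler0n.
rewrite (bigD1 a) //= ffunE eqxx big1 ?addr0 // => b /negbTE ba.
by rewrite ffunE ba.
Qed.

Lemma avail_pure m (a : A) : avail m (pure R a).
Proof. by case: m; [exact: is_dist_pure | exists a]. Qed.

Lemma avail_is_dist m p : avail m p -> is_dist p.
Proof. by case: m => // -[a ->]; exact: is_dist_pure. Qed.

Lemma is_dist_mix q p p' : 0 <= q <= 1 -> is_dist p -> is_dist p' -> is_dist (mix q p p').
Proof.
move=> /andP[q0 q1] [p0 p1] [p'0 p'1]; split=> [a|].
  by rewrite ffunE addr_ge0 // mulr_ge0 // subr_ge0.
under eq_bigr do rewrite ffunE.
by rewrite big_split /= -!mulr_sumr p1 p'1 !mulr1 addrC subrK.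
Qed.

Lemma sum_pure (a : A) f : \sum_b pure R a b * f b = f a.
Proof.
rewrite (bigD1 a) //= ffunE eqxx mul1r big1 ?addr0 // => b /negbTE ba.
by rewrite ffunE ba mul0r.
Qed.

Lemma dist_avg_const p c : is_dist p -> \sum_a p a * c = c.
Proof. by case=> _ p1; rewrite -mulr_suml p1 mul1r. Qed.

Lemma dist_avg_le p f f' : is_dist p -> (forall a, 0 < p a -> f a <= f' a) ->
  \sum_a p a * f a <= \sum_a p a * f' a.
Proof.
move=> [p0 p1] le_f; apply: ler_sum => a _.
have [pa|pa] := ltP 0 (p a); first by rewrite ler_pM2l // le_f.
by have /eqP -> : p a == 0; [rewrite eq_le pa p0 | rewrite !mul0r].
Qed.

Lemma dist_avg_supp p f c : is_dist p -> (forall a, 0 < p a -> f a = c) ->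
  \sum_a p a * f a = c.
Proof.
move=> dp fc; rewrite -[RHS](dist_avg_const c dp).
by apply/eqP; rewrite eq_le; apply/andP; split;
  apply: dist_avg_le => // a /fc ->.
Qed.

(** The source of every indifference argument: the gaps [c - f b], weighted by [p], are nonnegative
    and sum to zero, so each of them vanishes on the support. *)
Lemma dist_avg_max p f c : is_dist p -> (forall a, f a <= c) ->
  \sum_a p a * f a = c -> forall a, 0 < p a -> f a = c.
Proof.
move=> dp fc avg a pa.
have z : \sum_b p b * (c - f b) = 0.
  under eq_bigr do rewrite mulrBr.
  by rewrite sumrB dist_avg_const // avg subrr.
have nn b : true -> 0 <= p b * (c - f b).
  by case: dp => p0 _ _; rewrite mulr_ge0 // subr_ge0.
have /eqP := psumr_eq0P nn z (i := a) isT.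
by rewrite mulf_eq0 (gt_eqF pa) /= subr_eq0 => /eqP.
Qed.

Lemma dist_supp_exists p : is_dist p -> exists a, 0 < p a.
Proof.
move=> [p0 p1]; apply: contrapT => /forallNP np.
have : \sum_a p a = 0.
  by apply: big1 => a _; apply/eqP; rewrite eq_le p0 andbT leNgt; apply/negP.
by move/eqP; rewrite p1 oner_eq0.
Qed.

End Mixtures.

(** * Expected payoffs and equilibria of the stage game *)

Section Stage.
Set Implicit Arguments.
Unset Strict Implicit.
Variables (R : realType) (A1 A2 : finType).
Implicit Types u w : A1 -> A2 -> R.
Local Notation mixed1 := {ffun A1 -> R}.
Local Notation mixed2 := {ffun A2 -> R}.

(** With [w] the continuation values after each outcome, this is the one-shot game faced in the
    current round. *)
Definition boost u w : A1 -> A2 -> R := fun a1 a2 => u a1 a2 + w a1 a2.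

Lemma eu_boost u w s1 s2 : eu (boost u w) s1 s2 = eu u s1 s2 + eu w s1 s2.
Proof.
rewrite /eu -big_split; apply: eq_bigr => a1 _ /=.
by rewrite -big_split; apply: eq_bigr => a2 _ /=; rewrite mulrDr.
Qed.

Lemma eu_pure1 u a1 s2 : eu u (pure R a1) s2 = \sum_a2 s2 a2 * u a1 a2.
Proof.
rewrite /eu -(sum_pure a1 (fun a1 => \sum_a2 s2 a2 * u a1 a2)).
apply: eq_bigr => b _.
by rewrite mulr_sumr; apply: eq_bigr => c _; rewrite mulrA.
Qed.

Lemma eu_row u s1 s2 : eu u s1 s2 = \sum_a1 s1 a1 * eu u (pure R a1) s2.
Proof.
apply: eq_bigr => a1 _; rewrite eu_pure1 mulr_sumr.
by apply: eq_bigr => a2 _; rewrite mulrA.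
Qed.

Lemma eu_pure2 u s1 a2 : eu u s1 (pure R a2) = \sum_a1 s1 a1 * u a1 a2.
Proof. by rewrite eu_row; apply: eq_bigr => a1 _; rewrite eu_pure1 sum_pure. Qed.

Lemma eu_col u s1 s2 : eu u s1 s2 = \sum_a2 s2 a2 * eu u s1 (pure R a2).
Proof.
rewrite /eu exchange_big; apply: eq_bigr => a2 _ /=.
by rewrite -/(eu u s1 (pure R a2)) eu_pure2 mulr_sumr; apply: eq_bigr => a1 _; ring.
Qed.

Lemma eu_pure u a1 a2 : eu u (pure R a1) (pure R a2) = u a1 a2.
Proof. by rewrite eu_pure1 sum_pure. Qed.

Lemma eu_mix1 u q s1 t1 s2 :
  eu u (mix q s1 t1) s2 = q * eu u s1 s2 + (1 - q) * eu u t1 s2.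
Proof.
rewrite eu_row [in RHS]eu_row [eu u t1 s2]eu_row !mulr_sumr -big_split.
by apply: eq_bigr => a _ /=; rewrite ffunE; ring.
Qed.

Lemma eu_mix2 u q s1 s2 t2 :
  eu u s1 (mix q s2 t2) = q * eu u s1 s2 + (1 - q) * eu u s1 t2.
Proof.
rewrite eu_col [in RHS]eu_col [eu u s1 t2]eu_col !mulr_sumr -big_split.
by apply: eq_bigr => a _ /=; rewrite ffunE; ring.
Qed.

Lemma eu_const c (s1 : mixed1) (s2 : mixed2) : is_dist s1 -> is_dist s2 -> eu (fun _ _ => c) s1 s2 = c.
Proof.
move=> d1 d2; rewrite eu_row -[RHS](dist_avg_const c d1).
by apply: eq_bigr => a _; rewrite eu_pure1 dist_avg_const.
Qed.

Lemma eu_fun1 (f : A1 -> R) s1 (s2 : mixed2) : is_dist s2 ->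
  eu (fun a1 _ => f a1) s1 s2 = \sum_a1 s1 a1 * f a1.
Proof.
by move=> d2; rewrite eu_row; apply: eq_bigr => a _; rewrite eu_pure1 dist_avg_const.
Qed.

Lemma eu_fun2 (f : A2 -> R) (s1 : mixed1) s2 : is_dist s1 ->
  eu (fun _ a2 => f a2) s1 s2 = \sum_a2 s2 a2 * f a2.
Proof.
move=> d1; rewrite eu_col; apply: eq_bigr => a _; rewrite eu_pure2.
by rewrite dist_avg_const.
Qed.

Lemma eu_le_pure1 u s1 s2 c : is_dist s1 ->
  (forall a1, eu u (pure R a1) s2 <= c) -> eu u s1 s2 <= c.
Proof.
by move=> d1 le_c; rewrite eu_row -(dist_avg_const c d1); apply: dist_avg_le.
Qed.

Lemma eu_le_pure2 u s1 s2 c : is_dist s2 ->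
  (forall a2, eu u s1 (pure R a2) <= c) -> eu u s1 s2 <= c.
Proof.
by move=> d2 le_c; rewrite eu_col -(dist_avg_const c d2); apply: dist_avg_le.
Qed.

(** A mixed deviation earns an average of what pure ones earn, so only pure deviations matter.
    Regimes then differ only in which profiles are available. *)
Lemma stageNashP r u1 u2 (s1 : mixed1) (s2 : mixed2) : stageNash r u1 u2 s1 s2 <->
  [/\ avail (mixes1 r) s1, avail (mixes2 r) s2,
      (forall a1, eu u1 (pure R a1) s2 <= eu u1 s1 s2) &
      (forall a2, eu u2 s1 (pure R a2) <= eu u2 s1 s2)].
Proof.
split=> -[v1 v2 n1 n2]; split=> //.
- by move=> a1; apply: n1; exact: avail_pure.
- by move=> a2; apply: n2; exact: avail_pure.
- by move=> t1 /avail_is_dist d1; exact: eu_le_pure1.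
- by move=> t2 /avail_is_dist d2; exact: eu_le_pure2.
Qed.

Lemma stageNash_dist r u1 u2 s1 s2 : stageNash r u1 u2 s1 s2 -> is_dist s1 /\ is_dist s2.
Proof. by case=> v1 v2 _ _; split; [exact: avail_is_dist v1 | exact: avail_is_dist v2]. Qed.

Lemma stageNash_boost_const r u1 u2 w1 w2 c1 c2 (s1 : mixed1) (s2 : mixed2) :
  stageNash r (boost u1 w1) (boost u2 w2) s1 s2 ->
  stageNash r (boost u1 (fun a1 a2 => w1 a1 a2 + c1))
              (boost u2 (fun a1 a2 => w2 a1 a2 + c2)) s1 s2.
Proof.
have E u w c t1 t2 : is_dist t1 -> is_dist t2 ->
    eu (boost u (fun a1 a2 => w a1 a2 + c)) t1 t2 = eu (boost u w) t1 t2 + c.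
  move=> d1 d2; rewrite -[in RHS](eu_const c d1 d2) -eu_boost.
  by congr eu; apply/funext => a1; apply/funext => a2; rewrite /boost addrA.
move=> N; have [d1 d2] := stageNash_dist N; case: N => v1 v2 n1 n2; split=> //.
- by move=> t1 vt1; rewrite !E ?lerD2r ?n1 //; exact: avail_is_dist vt1.
- by move=> t2 vt2; rewrite !E ?lerD2r ?n2 //; exact: avail_is_dist vt2.
Qed.

Lemma payoff_bound u : exists2 B : R, 0 < B & forall s1 s2,
  is_dist s1 -> is_dist s2 -> - B <= eu u s1 s2 <= B.
Proof.
pose B := \sum_a1 \sum_a2 `|u a1 a2|.
have uB a1 a2 : `|u a1 a2| <= B.
  rewrite /B (bigD1 a1) //= (bigD1 a2) //= -addrA lerDl.
  by rewrite addr_ge0 ?sumr_ge0 // => *; rewrite sumr_ge0.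
have B0 : 0 <= B by rewrite /B sumr_ge0 // => *; rewrite sumr_ge0.
(* The [+ 1] keeps the bound positive when all payoffs vanish. *)
exists (B + 1) => [|s1 s2 d1 d2]; first by rewrite ltr_wpDl.
have uB' a1 a2 : - (B + 1) <= u a1 a2 <= B + 1.
  by rewrite -ler_norml (le_trans (uB _ _)) // lerDl.
apply/andP; split.
  rewrite eu_row -(dist_avg_const (- (B + 1)) d1); apply: dist_avg_le => // a1 _.
  rewrite eu_pure1 -(dist_avg_const (- (B + 1)) d2); apply: dist_avg_le => // a2 _.
  by case/andP: (uB' a1 a2).
apply: eu_le_pure1 => // a1; apply: eu_le_pure2 => // a2.
by rewrite eu_pure; case/andP: (uB' a1 a2).
Qed.

(* Whether a pure profile is an equilibrium does not depend on the regime. *)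
Lemma nonNash_pure r r' u1 u2 (s1 : mixed1) (s2 : mixed2) : avail (mixes1 r) s1 -> avail (mixes2 r) s2 ->
  ~ stageNash r u1 u2 s1 s2 ->
  exists a1 a2, ~ stageNash r' u1 u2 (pure R a1) (pure R a2).
Proof.
move=> v1 v2 nN; apply: contrapT => /forallNP allN; apply: nN.
have {}allN a1 a2 : stageNash r' u1 u2 (pure R a1) (pure R a2).
  by apply: contrapT => nN; apply: (allN a1); exists a2.
(* If all pure profiles are equilibria, averaging their inequalities with weights [s1] and [s2]
   gives those of the mixed profile. *)
have [d1 d2] := (avail_is_dist v1, avail_is_dist v2).
apply/stageNashP; split=> // [a1|a2].
  rewrite [leRHS]eu_row -[leLHS](dist_avg_const _ d1); apply: dist_avg_le => // b1 _.
  rewrite !eu_pure1; apply: dist_avg_le => // b2 _.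
  by have /stageNashP[_ _ /(_ a1) + _] := allN b1 b2; rewrite !eu_pure.
rewrite [leRHS]eu_col -[leLHS](dist_avg_const _ d2); apply: dist_avg_le => // b2 _.
rewrite !eu_pure2; apply: dist_avg_le => // b1 _.
by have /stageNashP[_ _ _ /(_ a2)] := allN b1 b2; rewrite !eu_pure.
Qed.

End Stage.

(** * Exchanging the two players *)

Section Swap.
Set Implicit Arguments.
Unset Strict Implicit.
Variables (R : realType) (A1 A2 : finType).

Lemma eu_swap (u : A1 -> A2 -> R) s1 s2 : eu (fun a2 a1 => u a1 a2) s2 s1 = eu u s1 s2.
Proof. by rewrite eu_row eu_col; apply: eq_bigr => a _; rewrite eu_pure1 eu_pure2. Qed.

Lemma stageNash_swap (u1 u2 : A1 -> A2 -> R) s1 s2 : stageNash MM u1 u2 s1 s2 ->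
  stageNash MM (fun a2 a1 => u2 a1 a2) (fun a2 a1 => u1 a1 a2) s2 s1.
Proof. by case=> ? ? n1 n2; split=> // t vt; rewrite !eu_swap; auto. Qed.

End Swap.

(** * Subgame perfection as a recursion on payoffs *)

Section Repeated.
Set Implicit Arguments.
Unset Strict Implicit.
Variables (R : realType) (A1 A2 : finType) (r : regime) (u1 u2 : A1 -> A2 -> R).

Local Notation strat1 := (strat R A1 A2 A1).
Local Notation strat2 := (strat R A1 A2 A2).

Definition build (A : finType) (p : {ffun A -> R}) (f : A1 * A2 -> strat R A1 A2 A) :
  strat R A1 A2 A := fun h => if h is a :: h' then f a h' else p.

Lemma val_cat u (s1 : strat1) (s2 : strat2) n h h' :
  Defs.val u s1 s2 n (h ++ h') = Defs.val u (cont h s1) (cont h s2) n h'.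
Proof.
elim: n h' => // n IH h' /=.
by do 2!apply: eq_bigr => ? _; rewrite -IH rcons_cat.
Qed.

Definition cval u (s1 : strat1) (s2 : strat2) n : A1 -> A2 -> R := fun a1 a2 =>
  Defs.val u (cont [:: (a1, a2)] s1) (cont [:: (a1, a2)] s2) n [::].

Lemma valS u s1 s2 n :
  Defs.val u s1 s2 n.+1 [::] = eu (boost u (cval u s1 s2 n)) (s1 [::]) (s2 [::]).
Proof. by do 2!apply: eq_bigr => ? _; rewrite /boost /cval -val_cat. Qed.

(** One-shot deviation principle. A deviation at the root that reverts to equilibrium play gives the
    first direction. Conversely, replacing the continuations of an arbitrary deviation by
    equilibrium ones does not lower its value, and what remains is a root deviation. *)
Lemma SPE_step n s1 s2 : SPE r u1 u2 n.+1 s1 s2 <->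
  [/\ availS (mixes1 r) s1, availS (mixes2 r) s2,
      stageNash r (boost u1 (cval u1 s1 s2 n)) (boost u2 (cval u2 s1 s2 n))
                (s1 [::]) (s2 [::]) &
      forall a, SPE r u1 u2 n (cont [:: a] s1) (cont [:: a] s2)].
Proof.
split=> [[v1 v2 H]|[v1 v2 N H]]; split=> //.
- have [_ _ n1 n2] := H [::] isT; split=> //.
  + move=> t1 vt; have := n1 (build t1 (fun a => cont [:: a] s1)).
    rewrite !valS; apply.
    by case=> [|a h] //=; exact: v1.
  + move=> t2 vt; have := n2 (build t2 (fun a => cont [:: a] s2)).
    rewrite !valS; apply.
    by case=> [|a h] //=; exact: v2.
- by move=> a; split=> [h|h|h hn]; [exact: v1 | exact: v2 | exact: (H (a :: h))].
- case=> [_|a h hn]; last by have [_ _ /(_ h hn)] := H a.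
  have [d1 d2] := stageNash_dist N; case: N => _ _ n1 n2.
  split=> // [t1 vt|t2 vt]; rewrite subn0 !valS /=.
  + apply: le_trans (n1 _ (vt [::])).
    have dt := avail_is_dist (vt [::]).
    rewrite !eu_boost lerD2l /=.
    rewrite eu_row [leRHS]eu_row; apply: dist_avg_le => // a1 _.
    rewrite !eu_pure1; apply: dist_avg_le => // a2 _; rewrite /cval.
    (* With no round left both continuation values are [0]; otherwise optimality in the subgame
       applies. *)
    case: n H {n1 n2} => // n H.
    have [_ _ /(_ [::] isT) [_ _ + _]] := H (a1, a2).
    by move=> /(_ (cont [:: (a1, a2)] t1)); apply=> h; exact: vt.
  + apply: le_trans (n2 _ (vt [::])).
    have dt := avail_is_dist (vt [::]).
    rewrite !eu_boost lerD2l /=.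
    rewrite eu_row [leRHS]eu_row; apply: dist_avg_le => // a1 _.
    rewrite !eu_pure1; apply: dist_avg_le => // a2 _; rewrite /cval.
    case: n H {n1 n2} => // n H.
    have [_ _ /(_ [::] isT) [_ _ _ +]] := H (a1, a2).
    by move=> /(_ (cont [:: (a1, a2)] t2)); apply=> h; exact: vt.
Qed.

(** Payoff pairs of subgame perfect equilibria, without strategies: a continuation pair is fixed for
    every outcome, on or off the path. *)
Inductive spe_payoff : nat -> R -> R -> Prop :=
| spe_payoff0 : spe_payoff 0 0 0
| spe_payoffS n (p1 : {ffun A1 -> R}) (p2 : {ffun A2 -> R}) w1 w2 :
    (forall a1 a2, spe_payoff n (w1 a1 a2) (w2 a1 a2)) ->
    stageNash r (boost u1 w1) (boost u2 w2) p1 p2 ->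
    spe_payoff n.+1 (eu (boost u1 w1) p1 p2) (eu (boost u2 w2) p1 p2).

(** The same recursion for equilibria with no locally suboptimal history. *)
Inductive local_payoff : nat -> R -> R -> Prop :=
| local_payoff0 : local_payoff 0 0 0
| local_payoffS n (p1 : {ffun A1 -> R}) (p2 : {ffun A2 -> R}) w1 w2 :
    (forall a1 a2, local_payoff n (w1 a1 a2) (w2 a1 a2)) ->
    stageNash r (boost u1 w1) (boost u2 w2) p1 p2 ->
    stageNash r u1 u2 p1 p2 ->
    local_payoff n.+1 (eu (boost u1 w1) p1 p2) (eu (boost u2 w2) p1 p2).

(** Abstract in [payoff]: necessity produces a root above [local_payoff], sufficiency builds one
    above [spe_payoff]. *)
Definition suboptimal_root (payoff : nat -> R -> R -> Prop) : Prop :=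
  exists n (p1 : {ffun A1 -> R}) (p2 : {ffun A2 -> R}) w1 w2,
    [/\ forall a1 a2, payoff n (w1 a1 a2) (w2 a1 a2),
        stageNash r (boost u1 w1) (boost u2 w2) p1 p2 & ~ stageNash r u1 u2 p1 p2].

(** The second equilibrium is played after the first whatever happened, which adds a constant to all
    continuations and leaves incentives unchanged. *)
Lemma spe_payoff_cat n m x1 x2 y1 y2 : spe_payoff n x1 x2 -> spe_payoff m y1 y2 ->
  spe_payoff (n + m) (x1 + y1) (x2 + y2).
Proof.
move=> Hx Hy; elim: Hx => [|k p1 p2 w1 w2 _ IH N]; first by rewrite !add0r.
have [d1 d2] := stageNash_dist N.
have E u w c : eu (boost u w) p1 p2 + c = eu (boost u (fun a1 a2 => w a1 a2 + c)) p1 p2.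
  rewrite -[in LHS](eu_const c d1 d2) -eu_boost.
  by congr eu; apply/funext => a1; apply/funext => a2; rewrite /boost addrA.
by rewrite !E addSn; apply: spe_payoffS => //; exact: stageNash_boost_const.
Qed.

Lemma spe_payoff_iter n k x y : spe_payoff n x y -> spe_payoff (k * n) (x *+ k) (y *+ k).
Proof.
move=> H; elim: k => [|k IH]; first exact: spe_payoff0.
by rewrite mulSn !mulrS; exact: spe_payoff_cat.
Qed.

Lemma spe_payoff_Nash p1 p2 : stageNash r u1 u2 p1 p2 ->
  spe_payoff 1 (eu u1 p1 p2) (eu u2 p1 p2).
Proof.
have E (u : A1 -> A2 -> R) : boost u (fun _ _ => 0) = u.
  by apply/funext => a1; apply/funext => a2; rewrite /boost addr0.
have := @spe_payoffS 0 p1 p2 _ _ (fun _ _ => spe_payoff0).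
by rewrite !E; apply.
Qed.

Lemma SPE_extend n p1 p2 w1 w2 :
  (forall a1 a2, exists s1 s2, [/\ SPE r u1 u2 n s1 s2,
     Defs.val u1 s1 s2 n [::] = w1 a1 a2 & Defs.val u2 s1 s2 n [::] = w2 a1 a2]) ->
  stageNash r (boost u1 w1) (boost u2 w2) p1 p2 ->
  exists s1 s2, [/\ SPE r u1 u2 n.+1 s1 s2, s1 [::] = p1 /\ s2 [::] = p2,
    Defs.val u1 s1 s2 n.+1 [::] = eu (boost u1 w1) p1 p2 &
    Defs.val u2 s1 s2 n.+1 [::] = eu (boost u2 w2) p1 p2].
Proof.
move=> H N.
have {}H (a : A1 * A2) : exists s : strat1 * strat2,
    [/\ SPE r u1 u2 n s.1 s.2, Defs.val u1 s.1 s.2 n [::] = w1 a.1 a.2 &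
        Defs.val u2 s.1 s.2 n [::] = w2 a.1 a.2].
  by have [s1 [s2 ?]] := H a.1 a.2; exists (s1, s2).
have [F HF] := choice H.
pose s1 := build p1 (fun a => (F a).1); pose s2 := build p2 (fun a => (F a).2).
have E1 : cval u1 s1 s2 n = w1.
  by apply/funext => a1; apply/funext => a2; have [] := HF (a1, a2).
have E2 : cval u2 s1 s2 n = w2.
  by apply/funext => a1; apply/funext => a2; have [] := HF (a1, a2).
exists s1, s2; rewrite !valS E1 E2; split=> //.
apply/SPE_step; rewrite E1 E2; split=> //.
- by case=> [|a h] /=; [case: N | have [[]] := HF a].
- by case=> [|a h] /=; [case: N | have [[]] := HF a].
- by move=> a; have [] := HF a.
Qed.

Lemma spe_payoff_SPE (hA1 : (0 < #|A1|)%N) (hA2 : (0 < #|A2|)%N) n x y :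
  spe_payoff n x y -> exists s1 s2,
    [/\ SPE r u1 u2 n s1 s2, Defs.val u1 s1 s2 n [::] = x & Defs.val u2 s1 s2 n [::] = y].
Proof.
(* Even a game of zero rounds needs some strategies, hence some actions. *)
have [[b1 _] [b2 _]] := (card_gt0P hA1, card_gt0P hA2).
elim=> [|{}n p1 p2 w1 w2 _ IH N].
  exists (fun _ => pure R b1), (fun _ => pure R b2).
  by split=> //; split=> // h; exact: avail_pure.
by have [s1 [s2 [? _ ? ?]]] := SPE_extend IH N; exists s1, s2.
Qed.

Lemma suboptimal_root_GLS (hA1 : (0 < #|A1|)%N) (hA2 : (0 < #|A2|)%N) :
  suboptimal_root spe_payoff -> in_GLS r u1 u2.
Proof.
move=> [n [p1 [p2 [w1 [w2 [H N nN]]]]]].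
have {}H a1 a2 := spe_payoff_SPE hA1 hA2 (H a1 a2).
have [s1 [s2 [S [E1 E2] _ _]]] := SPE_extend H N.
exists n.+1; split=> //; exists s1, s2; split=> //.
by exists [::]; rewrite E1 E2.
Qed.

Lemma SPE_local_payoff n s1 s2 : SPE r u1 u2 n s1 s2 ->
  ~ locally_suboptimal r u1 u2 n s1 s2 ->
  local_payoff n (Defs.val u1 s1 s2 n [::]) (Defs.val u2 s1 s2 n [::]).
Proof.
elim: n s1 s2 => [|n IH] s1 s2; first by move=> _ _; exact: local_payoff0.
move=> /SPE_step[v1 v2 N H] nL; rewrite !valS; apply: local_payoffS => // [a1 a2|].
  apply: IH => // -[h [hn nN]]; apply: nL.
  by exists ((a1, a2) :: h).
by apply: contrapT => nN; apply: nL; exists [::].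
Qed.

(* The root is found at a longest history where play is not a stage equilibrium. *)
Lemma GLS_suboptimal_root : in_GLS r u1 u2 -> suboptimal_root local_payoff.
Proof.
move=> [T [_ [s1 [s2 [+ L]]]]].
elim: T s1 s2 L => [|n IH] s1 s2; first by case=> h [].
move=> [h [hn nN]] /SPE_step[v1 v2 N H].
have [[a La]|/forallNP nL] :=
  pselect (exists a, locally_suboptimal r u1 u2 n (cont [:: a] s1) (cont [:: a] s2)).
  exact: IH La (H a).
exists n, (s1 [::]), (s2 [::]), (cval u1 s1 s2 n), (cval u2 s1 s2 n); split=> //.
  by move=> a1 a2; exact: SPE_local_payoff (H _) (nL _).
case: h hn nN => [//|a h hn nN]; have [] := nL a.
by exists h.
Qed.

End Repeated.

(** * Sets of equilibrium payoffs with at most one or several elements *)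

Section Cardinality.
Set Implicit Arguments.
Unset Strict Implicit.
Variable R : realType.
Implicit Types (V : R -> Prop) (c d : R).

Lemma card_gt1_or_const V : card_gt1 V \/ exists v, forall x, V x -> x = v.
Proof.
have [[x Vx]|/forallNP V0] := pselect (exists x, V x); last first.
  by right; exists 0 => x /V0.
have [[y [Vy xy]]|/forallNP H] := pselect (exists y, V y /\ x <> y).
  by left; exists x, y.
right; exists x => y Vy; apply: contrapT => yx.
by apply: (H y); split=> // /esym.
Qed.

Lemma card_is1_const V : card_is1 V -> exists v, forall x, V x -> x = v.
Proof. by case=> v [_ H]; exists v. Qed.

Lemma const_card_gt1F V v : (forall x, V x -> x = v) -> ~ card_gt1 V.
Proof. by move=> H [x [y [/H -> /H ->]]]. Qed.

Lemma card_gt1_lt V : card_gt1 V -> exists x y, [/\ V x, V y & y < x].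
Proof.
move=> [x [y [Vx Vy /eqP]]]; rewrite neq_lt => /orP[?|?]; first by exists y, x.
by exists x, y.
Qed.

Lemma exists_multiple c d : 0 < d -> exists n : nat, c <= d *+ n.
Proof.
move=> d0; exists (Num.bound `|c / d|).
rewrite -mulr_natr mulrC -ler_pdivrMr //.
by rewrite (le_trans (ler_norm _)) // ltW // archi_boundP.
Qed.

End Cardinality.

(** * Consequences of a last suboptimal history *)

Section Necessity.
Set Implicit Arguments.
Unset Strict Implicit.
Variables (R : realType) (A1 A2 : finType) (r : regime) (u1 u2 : A1 -> A2 -> R).
Local Notation local := (local_payoff r u1 u2).

Lemma boost_const (u : A1 -> A2 -> R) c p1 p2 : is_dist p1 -> is_dist p2 ->
  eu (boost u (fun _ _ => c)) p1 p2 = eu u p1 p2 + c.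
Proof. by move=> d1 d2; rewrite eu_boost eu_const. Qed.

(** By induction all continuations are worth the same, so each round adds one stage equilibrium
    payoff, which can only be [v]. *)
Lemma local_payoff_const1 v n x y : (forall x, V1 r u1 u2 x -> x = v) ->
  local n x y -> x = v *+ n.
Proof.
move=> cV; elim=> // {}n p1 p2 w1 w2 _ IH _ N; have [d1 d2] := stageNash_dist N.
have -> : w1 = fun _ _ => v *+ n by apply/funext => a1; apply/funext => a2.
by rewrite boost_const // mulrSr (cV (eu u1 p1 p2)) 1?addrC //; exists p1, p2.
Qed.

Lemma local_payoff_const2 v n x y : (forall y, V2 r u1 u2 y -> y = v) ->
  local n x y -> y = v *+ n.
Proof.
move=> cV; elim=> // {}n p1 p2 w1 w2 _ IH _ N; have [d1 d2] := stageNash_dist N.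
have -> : w2 = fun _ _ => v *+ n by apply/funext => a1; apply/funext => a2.
by rewrite boost_const // mulrSr (cV (eu u2 p1 p2)) 1?addrC //; exists p1, p2.
Qed.

(** Continuations worth the same after every outcome cannot reward or punish, so the incentives at
    the root are those of [u1] alone. *)
Lemma local_best_reply1 v n w1 w2 p1 p2 : (forall x, V1 r u1 u2 x -> x = v) ->
  (forall a1 a2, local n (w1 a1 a2) (w2 a1 a2)) ->
  stageNash r (boost u1 w1) (boost u2 w2) p1 p2 ->
  forall t1, avail (mixes1 r) t1 -> eu u1 t1 p2 <= eu u1 p1 p2.
Proof.
move=> cV H N t1 vt; have [d1 d2] := stageNash_dist N.
have E : w1 = fun _ _ => v *+ n.
  by apply/funext => a1; apply/funext => a2; exact: local_payoff_const1 cV (H _ _).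
case: N => _ _ /(_ t1 vt) + _.
by rewrite E !boost_const ?lerD2r //; exact: avail_is_dist vt.
Qed.

Lemma local_best_reply2 v n w1 w2 p1 p2 : (forall y, V2 r u1 u2 y -> y = v) ->
  (forall a1 a2, local n (w1 a1 a2) (w2 a1 a2)) ->
  stageNash r (boost u1 w1) (boost u2 w2) p1 p2 ->
  forall t2, avail (mixes2 r) t2 -> eu u2 p1 t2 <= eu u2 p1 p2.
Proof.
move=> cV H N t2 vt; have [d1 d2] := stageNash_dist N.
have E : w2 = fun _ _ => v *+ n.
  by apply/funext => a1; apply/funext => a2; exact: local_payoff_const2 cV (H _ _).
case: N => _ _ _ /(_ t2 vt).
by rewrite E !boost_const ?lerD2r //; exact: avail_is_dist vt.
Qed.

Lemma V1_V2_nonempty : (exists x, V1 r u1 u2 x) <-> (exists y, V2 r u1 u2 y).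
Proof.
by split=> -[_ [p1 [p2 [N _]]]]; [exists (eu u2 p1 p2) | exists (eu u1 p1 p2)];
  exists p1, p2.
Qed.

Lemma const_nonempty_card_is1 (V : R -> Prop) v :
  (forall x, V x -> x = v) -> (exists x, V x) -> card_is1 V.
Proof. by move=> cV [x Vx]; exists v; split=> //; rewrite -(cV x Vx). Qed.

(** If neither player had two equilibrium payoffs, both would play stage best replies at the root.
    The middle case keeps the continuations, from which the [Dset] condition of [C_mp] is read
    off. *)
Lemma suboptimal_root_cases : suboptimal_root r u1 u2 local ->
  [\/ [/\ card_gt1 (V1 r u1 u2), card_gt1 (V2 r u1 u2) &
        exists p1 p2, [/\ avail (mixes1 r) p1, avail (mixes2 r) p2 &
                          ~ stageNash r u1 u2 p1 p2]],
      [/\ card_gt1 (V1 r u1 u2), card_is1 (V2 r u1 u2) &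
        exists n p1 p2 w1 w2,
          [/\ forall a1 a2, local n (w1 a1 a2) (w2 a1 a2),
              stageNash r (boost u1 w1) (boost u2 w2) p1 p2,
              exists a1', eu u1 p1 p2 < eu u1 (pure R a1') p2 &
              forall t2, avail (mixes2 r) t2 -> eu u2 p1 t2 <= eu u2 p1 p2]] |
      [/\ card_is1 (V1 r u1 u2), card_gt1 (V2 r u1 u2) &
        exists p1 p2,
          [/\ avail (mixes1 r) p1, avail (mixes2 r) p2,
              exists a2', eu u2 p1 p2 < eu u2 p1 (pure R a2') &
              forall t1, avail (mixes1 r) t1 -> eu u1 t1 p2 <= eu u1 p1 p2]]].
Proof.
have ne V : card_gt1 V -> exists x : R, V x by case=> x [_ [Vx _ _]]; exists x.
move=> [n [p1 [p2 [w1 [w2 [H N nN]]]]]]; have [v1 v2 _ _] := N.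
have [g1|[x c1]] := card_gt1_or_const (V1 r u1 u2);
  have [g2|[y c2]] := card_gt1_or_const (V2 r u1 u2).
- by apply: Or31; split=> //; exists p1, p2.
- apply: Or32; split=> //.
    by apply: const_nonempty_card_is1 c2 _; apply/V1_V2_nonempty/ne.
  have br := local_best_reply2 c2 H N.
  exists n, p1, p2, w1, w2; split=> //.
  apply: contrapT => /forallNP best; apply: nN; apply/stageNashP; split=> //.
    by move=> a1; rewrite leNgt; apply/negP.
  by move=> a2; apply: br; exact: avail_pure.
- apply: Or33; split=> //.
    by apply: const_nonempty_card_is1 c1 _; apply/V1_V2_nonempty/ne.
  have br := local_best_reply1 c1 H N.
  exists p1, p2; split=> //.
  apply: contrapT => /forallNP best; apply: nN; apply/stageNashP; split=> //.
    by move=> a1; apply: br; exact: avail_pure.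
  by move=> a2; rewrite leNgt; apply/negP.
- by case: nN; split=> //;
    [exact: local_best_reply1 c1 H N | exact: local_best_reply2 c2 H N].
Qed.

(* Along a path on which player 1 only uses support actions, indifference makes
   the realized payoffs equal to the expected ones. *)
Lemma local_payoff_sum n x y : ~~ mixes2 r -> local n x y ->
  exists l : seq R, [/\ size l = n, forall v, v \in l -> V1 r u1 u2 v & x = \sum_(v <- l) v].
Proof.
move=> /negbTE pure2; elim=> [|{}n p1 p2 w1 w2 _ IH N1 N2].
  by exists [::]; rewrite big_nil.
have [d1 _] := stageNash_dist N1; have [a1 pa1] := dist_supp_exists d1.
have [b Eb] : exists b, p2 = pure R b by case: N1 => _; rewrite pure2.
have root u w : stageNash r u w p1 p2 -> u a1 b = eu u p1 p2.
  move=> /stageNashP[_ _ best _]; rewrite -(eu_pure u) -Eb.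
  by apply: (dist_avg_max d1 best) => //; rewrite -eu_row.
have [l [sl Vl wl]] := IH a1 b.
exists (eu u1 p1 p2 :: l); split=> /= [|v|]; first by rewrite sl.
  by rewrite inE => /orP[/eqP ->|/Vl //]; exists p1, p2.
by rewrite big_cons -wl -(root _ _ N1) -(root _ _ N2).
Qed.

End Necessity.

(** * From locally suboptimal play to [C_mm] and [C_mp] *)

Section NecessaryConditions.
Set Implicit Arguments.
Unset Strict Implicit.
Variables (R : realType) (A1 A2 : finType) (u1 u2 : A1 -> A2 -> R).

(** Equal lengths allow the two lists to be subtracted entry by entry. *)
Lemma Dset_sum_sub (l l' : seq R) : size l = size l' ->
  (forall v, v \in l -> V1 MP u1 u2 v) -> (forall v, v \in l' -> V1 MP u1 u2 v) ->
  exists ds : seq R, (forall d, d \in ds -> Dset u1 u2 d) /\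
    \sum_(v <- l) v - \sum_(v <- l') v = \sum_(d <- ds) d.
Proof.
elim: l l' => [|v l IH] [|v' l'] //= => [_ _ _|[sl] Vl Vl'].
  by exists [::]; rewrite !big_nil subrr.
have [||ds [Dds Sds]] := IH l' sl.
- by move=> z zl; apply: Vl; rewrite inE zl orbT.
- by move=> z zl; apply: Vl'; rewrite inE zl orbT.
exists (v - v' :: ds); split; last by rewrite !big_cons -Sds; ring.
move=> d; rewrite inE => /orP[/eqP ->|/Dds //].
have [p1 [p2 [N ->]]] := Vl v (mem_head _ _).
have [q1 [q2 [N' ->]]] := Vl' v' (mem_head _ _).
by exists p1, q1, p2, q2.
Qed.

Lemma GLS_C_mm : in_GLS MM u1 u2 -> C_mm u1 u2.
Proof.
move=> /GLS_suboptimal_root/suboptimal_root_cases[].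
- by move=> [g1 g2 H]; apply: Or31.
- move=> [g1 g2 [n [p1 [p2 [w1 [w2 [_ [d1 d2 _ _] [a1' lt] br]]]]]]].
  by apply: Or32; split=> //; exists p1, p2, a1'.
- move=> [g1 g2 [p1 [p2 [d1 d2 [a2' lt] br]]]].
  by apply: Or33; split=> //; exists p1, p2, a2'.
Qed.

Lemma GLS_C_mp : in_GLS MP u1 u2 -> C_mp u1 u2.
Proof.
move=> /GLS_suboptimal_root/suboptimal_root_cases[].
- move=> [g1 g2 [p1 [_ [d1 [a2 ->] nN]]]].
  by apply: Or31; split=> //; exists p1, a2.
- move=> [g1 g2 [n [p1 [p2 [w1 [w2 [H N [a1' lt] br]]]]]]].
  have [d1 [b Eb] _ _] := N; rewrite Eb in N lt br.
  apply: Or32; split=> //; exists p1, a1', b; split=> // [a2|_].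
    by apply: br; exists a2.
  have [a pa] := dist_supp_exists d1; exists a => // a' pa' _.
  (* Actions in the support are equally good once continuations are included. *)
  have root c : 0 < p1 c -> u1 c b + w1 c b = eu (boost u1 w1) p1 (pure R b).
    move=> pc; have /stageNashP[_ _ best _] := N.
    rewrite -[LHS](eu_pure (boost u1 w1)).
    by apply: (dist_avg_max d1 best) => //; rewrite -eu_row.
  have [l [sl Vl El]] := local_payoff_sum (r := MP) isT (H a b).
  have [l' [sl' Vl' El']] := local_payoff_sum (r := MP) isT (H a' b).
  (* The gap in stage payoffs between [a] and [a'] is the opposite gap in continuations, hence [l']
     minus [l]. *)
  have [ds [Dds Sds]] := Dset_sum_sub (etrans sl' (esym sl)) Vl' Vl.
  exists ds; split=> //; rewrite -Sds -El -El'.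
  by have := root a pa; rewrite -(root a' pa'); lra.
- move=> [g1 g2 [p1 [_ [d1 [a2 ->] [a2' lt] br]]]].
  by apply: Or33; split=> //; exists p1, a2, a2'.
Qed.

End NecessaryConditions.

(** * Reward and punishment in an arbitrary regime *)

Section Sufficiency.
Set Implicit Arguments.
Unset Strict Implicit.
Variables (R : realType) (A1 A2 : finType) (r : regime) (u1 u2 : A1 -> A2 -> R).
Local Notation payoff := (spe_payoff r u1 u2).

Lemma spe_payoff_sum (I : finType) (n : I -> nat) (x y : I -> R) :
  (forall i, payoff (n i) (x i) (y i)) ->
  payoff (\sum_i n i)%N (\sum_i x i) (\sum_i y i).
Proof.
move=> H; elim/big_rec3: _ => [|i y0 x0 m _ IH]; first exact: spe_payoff0.
exact: spe_payoff_cat.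
Qed.

(** Two independent phases follow the root, [M] rounds to discipline player 1 and [K] rounds for
    player 2. A unilateral deviation switches only the deviator's phase. *)
Lemma suboptimal_root_gt1 a1 a2 : card_gt1 (V1 r u1 u2) -> card_gt1 (V2 r u1 u2) ->
  ~ stageNash r u1 u2 (pure R a1) (pure R a2) -> suboptimal_root r u1 u2 payoff.
Proof.
move=> /card_gt1_lt[X [Y [[s1 [s2 [Ns EX]]] [s1' [s2' [Ns' EY]]] ltXY]]].
move=> /card_gt1_lt[Z [W [[t1 [t2 [Nt EZ]]] [t1' [t2' [Nt' EW]]] ltZW]]] nN.
have [B1 B1_gt0 bnd1] := payoff_bound u1; have [B2 B2_gt0 bnd2] := payoff_bound u2.
(* A one-round deviation gains at most twice the payoff bound, so these lengths make punishment
   outweigh it. *)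
have [M leM] : exists M : nat, 2 * B1 <= (X - Y) *+ M by apply: exists_multiple; lra.
have [K leK] : exists K : nat, 2 * B2 <= (Z - W) *+ K by apply: exists_multiple; lra.
rewrite mulrnBl in leM; rewrite mulrnBl in leK.
have Hs := spe_payoff_iter M (spe_payoff_Nash Ns).
have Hs' := spe_payoff_iter M (spe_payoff_Nash Ns').
have Ht := spe_payoff_iter K (spe_payoff_Nash Nt).
have Ht' := spe_payoff_iter K (spe_payoff_Nash Nt').
rewrite -?EX -?EY -?EZ -?EW in Hs Hs' Ht Ht'.
pose dev1 (b1 : A1) := b1 != a1; pose dev2 (b1 : A1) (b2 : A2) := (b1 == a1) && (b2 != a2).
pose w1 b1 b2 := (if dev1 b1 then Y *+ M else X *+ M) +
  (if dev2 b1 b2 then eu u1 t1' t2' *+ K else eu u1 t1 t2 *+ K).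
pose w2 b1 b2 := (if dev1 b1 then eu u2 s1' s2' *+ M else eu u2 s1 s2 *+ M) +
  (if dev2 b1 b2 then W *+ K else Z *+ K).
exists (M * 1 + K * 1)%N, (pure R a1), (pure R a2), w1, w2; split=> //.
  by move=> b1 b2; apply: spe_payoff_cat; case: ifP.
apply/stageNashP; split; [exact: avail_pure | exact: avail_pure | |] => b;
  rewrite !eu_pure /boost /w1 /w2 /dev1 /dev2 !eqxx /= ?andbF.
  have := bnd1 _ _ (is_dist_pure R b) (is_dist_pure R a2).
  have := bnd1 _ _ (is_dist_pure R a1) (is_dist_pure R a2); rewrite !eu_pure.
  by case: eqVneq => [->|_] /=; lra.
have := bnd2 _ _ (is_dist_pure R a1) (is_dist_pure R b).
have := bnd2 _ _ (is_dist_pure R a1) (is_dist_pure R a2); rewrite !eu_pure.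
by case: eqVneq => [->|_] /=; lra.
Qed.

(** Player 2 plays a pure action, so deviations are observed and punished. Player 1 gets [v *+ K]
    whatever happens and keeps best replying in the stage game. *)
Lemma suboptimal_root_const1 v p1 a2 a2' : (forall x, V1 r u1 u2 x -> x = v) ->
  card_gt1 (V2 r u1 u2) -> avail (mixes1 r) p1 ->
  eu u2 p1 (pure R a2) < eu u2 p1 (pure R a2') ->
  (forall a1, eu u1 (pure R a1) (pure R a2) <= eu u1 p1 (pure R a2)) ->
  suboptimal_root r u1 u2 payoff.
Proof.
move=> cV /card_gt1_lt[Z [W [[t1 [t2 [Nt EZ]]] [t1' [t2' [Nt' EW]]] ltZW]]] vp lt br.
have [B2 B2_gt0 bnd2] := payoff_bound u2.
have [K leK] : exists K : nat, 2 * B2 <= (Z - W) *+ K by apply: exists_multiple; lra.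
rewrite mulrnBl in leK.
have Ht := spe_payoff_iter K (spe_payoff_Nash Nt).
have Ht' := spe_payoff_iter K (spe_payoff_Nash Nt').
have vE q1 q2 : stageNash r u1 u2 q1 q2 -> eu u1 q1 q2 = v.
  by move=> N; apply: cV; exists q1, q2.
rewrite (vE _ _ Nt) -EZ in Ht; rewrite (vE _ _ Nt') -EW in Ht'.
pose w2 (b1 : A1) (b2 : A2) := if b2 != a2 then W *+ K else Z *+ K.
have d1 := avail_is_dist vp; have d2 := is_dist_pure R a2.
exists (K * 1)%N, p1, (pure R a2), (fun _ _ => v *+ K), w2; split.
- by move=> b1 b2; rewrite /w2; case: ifP.
- apply/stageNashP; split=> // [|b1|b2]; first exact: avail_pure.
    by rewrite !boost_const ?lerD2r //; exact: is_dist_pure.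
  rewrite !eu_boost !eu_fun2 // !sum_pure eqxx /=.
  have := bnd2 _ _ d1 (is_dist_pure R b2); have := bnd2 _ _ d1 d2.
  by case: eqVneq => [->|_] /=; lra.
- by move=> /stageNashP[_ _ _ /(_ a2')]; rewrite leNgt lt.
Qed.

(** Player 2 faces the constant continuation [y] and keeps a stage best reply, while [w] levels the
    support of [p1] at [c]. The strict gain from [a1'] is what makes the root suboptimal. *)
Lemma suboptimal_root_incentive p1 p2 a1' n (w : A1 -> R) y c :
  avail (mixes1 r) p1 -> avail (mixes2 r) p2 ->
  eu u1 p1 p2 < eu u1 (pure R a1') p2 ->
  (forall a2, eu u2 p1 (pure R a2) <= eu u2 p1 p2) ->
  (forall a1, payoff n (w a1) y) ->
  (forall a1, 0 < p1 a1 -> eu u1 (pure R a1) p2 + w a1 = c) ->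
  (forall a1, eu u1 (pure R a1) p2 + w a1 <= c) ->
  suboptimal_root r u1 u2 payoff.
Proof.
move=> vp1 vp2 lt br Hw on off.
have d1 := avail_is_dist vp1; have d2 := avail_is_dist vp2.
exists n, p1, p2, (fun a1 _ => w a1), (fun _ _ => y); split=> //; last first.
  by move=> /stageNashP[_ _ /(_ a1') + _]; rewrite leNgt lt.
apply/stageNashP; split=> // [a1|a2]; last first.
  by rewrite !boost_const ?lerD2r //; exact: is_dist_pure.
have row a : eu (boost u1 (fun a1 _ => w a1)) (pure R a) p2 = eu u1 (pure R a) p2 + w a.
  by rewrite eu_boost eu_fun1 // sum_pure.
rewrite row [leRHS]eu_row (dist_avg_supp (c := c)) // => a pa.
by rewrite row on.
Qed.

End Sufficiency.

(** * Sufficiency when only player 1 mixes *)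

Section SufficientMP.
Set Implicit Arguments.
Unset Strict Implicit.
Variables (R : realType) (A1 A2 : finType) (u1 u2 : A1 -> A2 -> R).

(** Each [d] is the gap between two stage equilibria. Playing the lower or the upper term of every
    gap gives two equilibria of equal length, both worth [v] per round to player 2. *)
Lemma spe_payoff_Dset v (ds : seq R) : (forall y, V2 MP u1 u2 y -> y = v) ->
  (forall d, d \in ds -> Dset u1 u2 d) ->
  exists n x, spe_payoff MP u1 u2 n x (v *+ n) /\
              spe_payoff MP u1 u2 n (x + \sum_(d <- ds) d) (v *+ n).
Proof.
move=> cV; elim: ds => [_|d ds IH Dds].
  by exists 0%N, 0; rewrite big_nil addr0; split; exact: spe_payoff0.
have [|n [x [H H']]] := IH; first by move=> e eds; apply: Dds; rewrite inE eds orbT.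
have [p1 [q1 [p2 [q2 [N N' Ed]]]]] := Dds d (mem_head _ _).
have vE t1 t2 : stageNash MP u1 u2 t1 t2 -> eu u2 t1 t2 = v.
  by move=> ?; apply: cV; exists t1, t2.
have := spe_payoff_cat (spe_payoff_Nash N') H.
have := spe_payoff_cat (spe_payoff_Nash N) H'.
rewrite (vE _ _ N) (vE _ _ N') -mulrS big_cons add1n => K K'.
exists n.+1, (eu u1 q1 q2 + x); split=> //.
by have -> : eu u1 q1 q2 + x + (d + \sum_(j <- ds) j) =
  eu u1 p1 p2 + (x + \sum_(j <- ds) j) by rewrite Ed; ring.
Qed.

Lemma C_mp_GLS (hA1 : (0 < #|A1|)%N) (hA2 : (0 < #|A2|)%N) :
  C_mp u1 u2 -> in_GLS MP u1 u2.
Proof.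
move=> C; apply: suboptimal_root_GLS => //; case: C.
- move=> [g1 g2 [p1 [a2 [d1 nN]]]].
  have [b1 [b2 nN']] := nonNash_pure MP (r := MP) d1 (avail_pure R false a2) nN.
  exact: suboptimal_root_gt1 g1 g2 nN'.
- move=> [g1 /card_is1_const[v cV] [p1 [a1' [b [d1 lt br D]]]]].
  (* With a one-point support the condition on the other actions is vacuous. *)
  have {D}[a pa D] : exists2 a, 0 < p1 a & forall a', 0 < p1 a' -> a' != a ->
      exists ds : seq R, (forall d, d \in ds -> Dset u1 u2 d) /\
                       u1 a b - u1 a' b = \sum_(d <- ds) d.
    have [/D[a pa Da]|] := ltnP 1 #|supp p1|; first by exists a.
    have [a pa] := dist_supp_exists d1; move=> /card_le1P/(_ a pa) sa.
    exists a => // a' pa'; have := sa a'.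
    by rewrite !inE pa' => /esym ->.
  (* One block of rounds per action [a'], in a base version and in one that adds the compensation
     owed after [a']; it is empty when nothing is owed. *)
  have blocks a' : exists b0 : nat * R, spe_payoff MP u1 u2 b0.1 b0.2 (v *+ b0.1) /\
      spe_payoff MP u1 u2 b0.1 (b0.2 + if 0 < p1 a' then u1 a b - u1 a' b else 0)
                 (v *+ b0.1).
    case: ifP => pa'; last first.
      by exists (0%N, 0); rewrite addr0; split; exact: spe_payoff0.
    have [->|a'a] := eqVneq a' a.
      by exists (0%N, 0); rewrite subrr addr0; split; exact: spe_payoff0.
    have [ds [Dds ->]] := D a' pa' a'a.
    by have [n [x ?]] := spe_payoff_Dset cV Dds; exists (n, x).
  have {blocks}[f Hf] := choice blocks.
  have [X [Y [[s1 [s2 [N EX]]] [s1' [s2' [N' EY]]] ltXY]]] := card_gt1_lt g1.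
  have [B B_gt0 bnd] := payoff_bound u1.
  have [K leK] : exists K : nat, 2 * B <= (X - Y) *+ K by apply: exists_multiple; lra.
  rewrite mulrnBl in leK.
  have vE t1 t2 : stageNash MP u1 u2 t1 t2 -> eu u2 t1 t2 = v.
    by move=> ?; apply: cV; exists t1, t2.
  have := spe_payoff_iter K (spe_payoff_Nash N).
  have := spe_payoff_iter K (spe_payoff_Nash N').
  rewrite (vE _ _ N) (vE _ _ N') -EX -EY => HY HX.
  (* All blocks are played in the base version except that of the realized action. [K] more rounds
     punish actions outside the support. *)
  pose S := \sum_i (f i).2.
  pose w a' := (S + if 0 < p1 a' then u1 a b - u1 a' b else 0) +
               (if 0 < p1 a' then X *+ K else Y *+ K).
  apply: (suboptimal_root_incentive (p1 := p1) (p2 := pure R b) (a1' := a1')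
    (n := (\sum_i (f i).1 + K * 1)%N) (w := w)
    (y := (\sum_i v *+ (f i).1) + v *+ K) (c := u1 a b + S + X *+ K)) => //.
  + by exists b.
  + move=> a'; apply: spe_payoff_cat; last by case: ifP.
    rewrite /S; set e := (if _ then _ else _).
    have -> : \sum_i (f i).2 + e = \sum_i ((f i).2 + if i == a' then e else 0).
      by rewrite big_split /= -big_mkcond big_pred1_eq.
    apply: spe_payoff_sum => i; have [H H'] := Hf i.
    by case: eqP => [Ei|_]; [rewrite Ei in H' * | rewrite addr0].
  + by move=> a' pa'; rewrite eu_pure /w pa'; ring.
  + move=> a'; rewrite eu_pure /w; case: ifP => _; first by lra.
    have := bnd _ _ (is_dist_pure R a') (is_dist_pure R b).
    have := bnd _ _ (is_dist_pure R a) (is_dist_pure R b).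
    by rewrite !eu_pure; lra.
- move=> [/card_is1_const[v cV] g2 [p1 [a2 [a2' [d1 lt br]]]]].
  apply: (suboptimal_root_const1 cV g2 (p1 := p1)) lt _ => // a1.
  by apply: br; exact: is_dist_pure.
Qed.

End SufficientMP.

(** * Lotteries over continuations when both players mix *)

Section Lottery.
Set Implicit Arguments.
Unset Strict Implicit.
Variables (R : realType) (A1 A2 : finType) (u1 u2 : A1 -> A2 -> R).
Local Notation payoff := (spe_payoff MM u1 u2).

(** The length [n] and player 2's payoff [e] are common to the whole interval, so its points act as
    incentives for player 1 alone. *)
Definition attains_interval : Prop := exists n c d e q1 q2,
  [/\ 0 < d, q1 < q2 & forall q, q1 <= q <= q2 -> payoff n (c + q * d) e].

(* Repeating the interval makes it long enough to make player 1 indifferent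
   between any actions. *)
Lemma attains_interval_suboptimal p1 p2 a1' : attains_interval ->
  is_dist p1 -> is_dist p2 -> eu u1 p1 p2 < eu u1 (pure R a1') p2 ->
  (forall a2, eu u2 p1 (pure R a2) <= eu u2 p1 p2) ->
  suboptimal_root MM u1 u2 payoff.
Proof.
move=> [n [c [d [e [q1 [q2 [d0 ltq H]]]]]]] d1 d2 lt br.
have [B B0 bnd] := payoff_bound u1.
have [m lem] : exists m : nat, 2 * B <= ((q2 - q1) * d) *+ m.
  by apply: exists_multiple; rewrite mulr_gt0 // subr_gt0.
have m0 : 0 < m%:R :> R.
  by rewrite ltr0n; case: m lem => //; rewrite mulr0n; lra.
pose x := (c + q1 * d) * m%:R.
have Hm z : 0 <= z <= 2 * B -> payoff (m * n) (x + z) (e *+ m).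
  move=> /andP[z0 zB]; pose q := q1 + z / (m%:R * d).
  have md0 : 0 < m%:R * d by rewrite mulr_gt0.
  have -> : x + z = (c + q * d) *+ m.
    by rewrite -mulr_natr /x /q; field; rewrite !gt_eqF.
  apply: spe_payoff_iter; apply: H; rewrite lerDl divr_ge0 ?(ltW md0) //=.
  rewrite -lerBrDl ler_pdivrMr //; apply: le_trans zB (le_trans lem _).
  by rewrite -mulr_natr; lra.
pose U a := eu u1 (pure R a) p2.
have UB a : - B <= U a <= B by apply: bnd => //; exact: is_dist_pure.
(* Each support action is topped up to total [x + B], which costs between [0] and [2 * B]; other
   actions get no top-up and stay below. *)
apply: (suboptimal_root_incentive (p1 := p1) (p2 := p2) (n := (m * n)%N) (y := e *+ m)
  (w := fun a => x + if 0 < p1 a then B - U a else 0) (c := x + B)) lt br _ _ _ => //.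
- by move=> a; apply: Hm; have := UB a; case: ifP => _; lra.
- by move=> a ->; rewrite -/(U a); ring.
- by move=> a; rewrite -/(U a); have := UB a; case: ifP => _; lra.
Qed.

Definition tie (p1 : {ffun A1 -> R}) (b b' : A2) : Prop :=
  [/\ is_dist p1, b != b', forall c, eu u2 p1 (pure R c) <= eu u2 p1 (pure R b) &
      eu u2 p1 (pure R b') = eu u2 p1 (pure R b)].

Lemma eu_tie p1 b b' q : tie p1 b b' ->
  eu u2 p1 (mix q (pure R b) (pure R b')) = eu u2 p1 (pure R b).
Proof. by case=> _ _ _ E; rewrite eu_mix2 E; ring. Qed.

Variables (s1 s1' : {ffun A1 -> R}) (s2 s2' : {ffun A2 -> R}) (v : R).
Hypotheses (N : stageNash MM u1 u2 s1 s2) (N' : stageNash MM u1 u2 s1' s2').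
Hypothesis cV : forall y, V2 MM u1 u2 y -> y = v.
Local Notation X := (eu u1 s1 s2).
Local Notation Y := (eu u1 s1' s2').
Hypothesis ltXY : Y < X.

(** The first equilibrium is played [k] times and the second in the remaining rounds; player 2 earns
    [v] per round from either. *)
Lemma spe_payoff_two_Nash k n : (k <= n)%N -> payoff n (Y *+ n + (X - Y) *+ k) (v *+ n).
Proof.
move=> /subnK <-; set j := (n - k)%N.
have := spe_payoff_iter j (spe_payoff_Nash N').
have := spe_payoff_iter k (spe_payoff_Nash N).
have -> : eu u2 s1 s2 = v by apply: cV; exists s1, s2.
have -> : eu u2 s1' s2' = v by apply: cV; exists s1', s2'.
rewrite !muln1 => H /spe_payoff_cat/(_ H); rewrite -mulrnDr.
by rewrite mulrnDr mulrnBl; congr (payoff _ _ _); ring.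
Qed.

(** Any odds between tied best replies are optimal for player 2, whose continuation is constant;
    only player 1's incentives remain. *)
Lemma tie_stageNash_boost p1 b b' q w1 e : tie p1 b b' -> 0 <= q <= 1 ->
  let p2 := mix q (pure R b) (pure R b') in
  (forall a, eu (boost u1 w1) (pure R a) p2 <= eu (boost u1 w1) p1 p2) ->
  stageNash MM (boost u1 w1) (boost u2 (fun _ _ => e)) p1 p2.
Proof.
move=> T q01 p2 best; have [d1 _ br _] := T.
have d2 : is_dist p2 by apply: is_dist_mix => //; exact: is_dist_pure.
apply/stageNashP; split=> // a.
by rewrite !boost_const ?lerD2r //; [rewrite eu_tie | exact: is_dist_pure].
Qed.

Lemma eu_boost_mix (w : A1 -> A2 -> R) a q b b' :
  eu (boost u1 w) (pure R a) (mix q (pure R b) (pure R b')) =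
  q * (u1 a b + w a b) + (1 - q) * (u1 a b' + w a b').
Proof. by rewrite eu_mix2 !eu_pure. Qed.

(* Player 2's choice between the tied actions is a lottery with arbitrary odds. *)
Lemma pure_tie_attains_interval a b b' : tie (pure R a) b b' -> attains_interval.
Proof.
move=> T; have [d1 bb' br E] := T; have [B B0 bnd] := payoff_bound u1.
have [M leM] : exists M : nat, 2 * B + 1 <= (X - Y) *+ M.
  by apply: exists_multiple; rewrite subr_gt0.
(* Number of rewarded rounds: at least [M] after [a], which deters deviations, and [M] more after
   [b], which makes the payoff strictly increasing in [q]. *)
pose k c1 c2 := if c1 == a then (if c2 == b then M + M else M)%N else 0%N.
pose w1 c1 c2 := Y *+ (M + M) + (X - Y) *+ k c1 c2.
have uB c1 c2 : - B <= u1 c1 c2 <= B.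
  by rewrite -(eu_pure u1); apply: bnd; exact: is_dist_pure.
exists (M + M).+1, (u1 a b' + w1 a b'), ((u1 a b + w1 a b) - (u1 a b' + w1 a b')).
exists (u2 a b + v *+ (M + M)), 0, 1.
have kab : k a b = (M + M)%N by rewrite /k !eqxx.
have kab' : k a b' = M by rewrite /k eqxx eq_sym (negbTE bb').
split=> [||q q01]; [|exact: ltr01|].
  have := uB a b; have := uB a b'.
  by rewrite /w1 kab kab' [in (X - Y) *+ (M + M)]mulrnDr; lra.
have NB := tie_stageNash_boost (w1 := w1) (v *+ (M + M)) T q01.
have d2 : is_dist (mix q (pure R b) (pure R b')).
  by apply: is_dist_mix => //; exact: is_dist_pure.
have -> : u1 a b' + w1 a b' + q * (u1 a b + w1 a b - (u1 a b' + w1 a b')) =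
    eu (boost u1 w1) (pure R a) (mix q (pure R b) (pure R b')).
  by rewrite eu_boost_mix; ring.
have -> : u2 a b + v *+ (M + M) = eu (boost u2 (fun _ _ => v *+ (M + M)))
    (pure R a) (mix q (pure R b) (pure R b')).
  by rewrite boost_const // eu_tie // eu_pure.
apply: spe_payoffS => [c1 c2|].
  apply: spe_payoff_two_Nash; rewrite /k; case: ifP => // _.
  by case: ifP => // _; exact: leq_addr.
apply: NB => c; have [->//|ca] := eqVneq c a.
rewrite !eu_boost_mix /w1 kab kab' /k (negbTE ca) mulr0n mulrnDr.
have := bnd _ _ (is_dist_pure R c) d2; have := bnd _ _ (is_dist_pure R a) d2.
rewrite !eu_mix2 !eu_pure; case/andP: q01 => q0 q1.
have : 0 <= q * ((X - Y) *+ M) by apply: mulr_ge0 => //; lra.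
by lra.
Qed.

Section MixedTie.
Variables (a a' : A1) (b b' : A2) (p : R) (M : nat) (B : R).
Hypotheses (aa' : a != a') (p01 : 0 < p < 1).
Local Notation p1 := (mix p (pure R a) (pure R a')).
Local Notation p2 q := (mix q (pure R b) (pure R b')).
Hypothesis T : tie p1 b b'.
Hypotheses (bnd : forall s1 s2, is_dist s1 -> is_dist s2 -> - B <= eu u1 s1 s2 <= B).
Hypothesis leM : 2 * B + 1 <= (X - Y) *+ M.

Lemma dist_p2 q : 0 <= q <= 1 -> is_dist (p2 q).
Proof. by move=> q01; apply: is_dist_mix => //; exact: is_dist_pure. Qed.

(* The lottery compensating player 1: [q] solves the indifference between [a]
   and [a'] when [(a', b)] is rewarded [M] times and [(a, b')] is rewarded [j] times. *)
Lemma mixed_tie_compensated j q (t := u1 a b' - u1 a' b' + (X - Y) *+ j)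
    (s := (X - Y) *+ M - (u1 a b - u1 a' b)) :
  (j <= M.+1)%N -> 0 <= q <= 1 -> q * (t + s) = t ->
  stageNash MM u1 u2 p1 (p2 q) \/ suboptimal_root MM u1 u2 payoff.
Proof.
move=> jM q01 Eq; have [|nN] := pselect (stageNash MM u1 u2 p1 (p2 q)); first by left.
(* A base of [M] rewards after [a] or [a'] deters all other actions; the [j] and [M] rewards that
   create indifference come on top. *)
right; pose k c1 c2 := if c1 == a then (if c2 == b' then M + j else M)%N else
  if c1 == a' then (if c2 == b then M + M else M)%N else 0%N.
have [_ bb' _ _] := T.
have kab : k a b = M by rewrite /k eqxx (negbTE bb').
have kab' : k a b' = (M + j)%N by rewrite /k !eqxx.
have ka'b : k a' b = (M + M)%N by rewrite /k eq_sym (negbTE aa') !eqxx.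
have ka'b' : k a' b' = M by rewrite /k eq_sym (negbTE aa') eqxx eq_sym (negbTE bb').
(* One round beyond [M + M] leaves room for [M + j] when [j] is [M.+1]. *)
pose n := (M + M).+1; pose w1 c1 c2 := Y *+ n + (X - Y) *+ k c1 c2.
exists n, p1, (p2 q), w1, (fun _ _ => v *+ n); split=> // [c1 c2|].
  apply: spe_payoff_two_Nash; rewrite /k /n.
  have lej : (M + j <= (M + M).+1)%N by rewrite -addnS leq_add2l.
  have leM1 : (M <= (M + M).+1)%N by rewrite leqW ?leq_addr.
  by do !case: ifP => _ //; exact: leqnSn.
apply: tie_stageNash_boost => // c; rewrite eu_mix1.
have Ea' : eu (boost u1 w1) (pure R a') (p2 q) = eu (boost u1 w1) (pure R a) (p2 q).
  rewrite !eu_boost_mix /w1 kab kab' ka'b ka'b' !mulrnDr.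
  by rewrite /t /s in Eq; lra.
have -> : p * eu (boost u1 w1) (pure R a) (p2 q) +
  (1 - p) * eu (boost u1 w1) (pure R a') (p2 q) = eu (boost u1 w1) (pure R a) (p2 q).
  by rewrite Ea'; ring.
have [->//|ca] := eqVneq c a; have [->|ca'] := eqVneq c a'; first by rewrite Ea'.
rewrite !eu_boost_mix /w1 kab kab' /k (negbTE ca) (negbTE ca') mulr0n mulrnDr.
have := bnd (is_dist_pure R c) (dist_p2 q01); have := bnd (is_dist_pure R a) (dist_p2 q01).
rewrite !eu_mix2 !eu_pure; case/andP: q01 => q0 q1.
have : 0 <= (1 - q) * ((X - Y) *+ j).
  by rewrite mulr_ge0 ?subr_ge0 // mulrn_wge0 // subr_ge0 ltW.
move: leM; set P := (X - Y) *+ M; set Q := (X - Y) *+ j; set Z := Y *+ n.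
by lra.
Qed.

(** Player 1's equilibrium inequalities are affine in [q], so they hold between [q1] and [q2].
    Continuations depending only on player 2's action preserve them and give player 1 a payoff with
    positive slope in [q]. *)
Lemma mixed_tie_Nash_interval q1 q2 : q1 < q2 -> 0 <= q1 <= 1 -> 0 <= q2 <= 1 ->
  stageNash MM u1 u2 p1 (p2 q1) -> stageNash MM u1 u2 p1 (p2 q2) -> attains_interval.
Proof.
move=> lt12 q101 q201 /stageNashP[_ _ n1 _] /stageNashP[_ _ n2 _].
have [d1 bb' _ _] := T.
have Nq q : q1 <= q <= q2 -> forall c, eu u1 (pure R c) (p2 q) <= eu u1 p1 (p2 q).
  move=> /andP[le1 le2] c; have := n1 c; have := n2 c; rewrite !eu_mix2 => h2 h1.
  (* Scaled by [q2 - q1], the slack at [q] is [q2 - q] times the slack at [q1] plus [q - q1] times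
     the slack at [q2]. *)
  rewrite -subr_ge0 -(pmulr_rge0 _ (_ : 0 < q2 - q1)) ?subr_gt0 //.
  set g := eu u1 p1 (pure R b) in h1 h2 *; set g' := eu u1 p1 (pure R b') in h1 h2 *.
  set f := eu u1 (pure R c) (pure R b) in h1 h2 *.
  set f' := eu u1 (pure R c) (pure R b') in h1 h2 *.
  have i1 : 0 <= (q2 - q) * (q1 * g + (1 - q1) * g' - (q1 * f + (1 - q1) * f')).
    by rewrite mulr_ge0 // subr_ge0.
  have i2 : 0 <= (q - q1) * (q2 * g + (1 - q2) * g' - (q2 * f + (1 - q2) * f')).
    by rewrite mulr_ge0 // subr_ge0.
  by apply: le_trans (addr_ge0 i1 i2) _; rewrite le_eqVlt; apply/orP; left; apply/eqP; ring.
pose w1 (c1 : A1) c2 := if c2 == b then X *+ M else Y *+ M.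
pose g c := eu u1 p1 (pure R c).
exists M.+1, (g b' + Y *+ M), ((g b + X *+ M) - (g b' + Y *+ M)).
exists (eu u2 p1 (pure R b) + v *+ M), q1, q2; split=> // [|q q12].
  have := bnd d1 (is_dist_pure R b); have := bnd d1 (is_dist_pure R b').
  by move: leM; rewrite -/(g b) -/(g b') mulrnBl; lra.
have q01 : 0 <= q <= 1 by case/andP: q12 q101 q201 => *; lra.
have d2 := dist_p2 q01.
have Ew p0 : is_dist p0 -> eu w1 p0 (p2 q) = q * (X *+ M) + (1 - q) * (Y *+ M).
  move=> d0; rewrite eu_mix2 !eu_fun2 // !sum_pure eqxx.
  by rewrite eq_sym (negbTE bb').
have -> : g b' + Y *+ M + q * (g b + X *+ M - (g b' + Y *+ M)) =
    eu (boost u1 w1) p1 (p2 q).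
  by rewrite eu_boost Ew // eu_mix2 -/(g b) -/(g b'); ring.
have -> : eu u2 p1 (pure R b) + v *+ M = eu (boost u2 (fun _ _ => v *+ M)) p1 (p2 q).
  by rewrite boost_const // eu_tie.
apply: spe_payoffS => [c1 c2|].
  rewrite /w1; case: ifP => _.
    by have := spe_payoff_two_Nash (leqnn M); rewrite -mulrnDl addrC subrK.
  by have := spe_payoff_two_Nash (leq0n M); rewrite mulr0n addr0.
apply: tie_stageNash_boost => // c; rewrite !eu_boost !Ew ?lerD2r ?Nq //.
exact: is_dist_pure.
Qed.

(** The compensated profile is tried with [j = M] and [j = M.+1]. If one is not a stage equilibrium,
    it is a suboptimal root; otherwise two distinct odds give stage equilibria and bound an
    interval. *)
Lemma mixed_tie_attains_interval :
  attains_interval \/ suboptimal_root MM u1 u2 payoff.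
Proof.
pose t j := u1 a b' - u1 a' b' + (X - Y) *+ j.
pose s := (X - Y) *+ M - (u1 a b - u1 a' b).
have uB c1 c2 : - B <= u1 c1 c2 <= B.
  by rewrite -(eu_pure u1); apply: bnd; exact: is_dist_pure.
have s0 : 0 < s by move: leM; rewrite /s; have := uB a b; have := uB a' b; lra.
have tM : 0 < t M by move: leM; rewrite /t; have := uB a b'; have := uB a' b'; lra.
have tS : t M.+1 = t M + (X - Y) by rewrite /t mulrS; ring.
have tM1 : 0 < t M.+1 by rewrite tS addr_gt0 // subr_gt0.
have q01 x : 0 < x -> 0 <= x / (x + s) <= 1.
  move=> x0; have xs := addr_gt0 x0 s0.
  by rewrite ltW ?divr_gt0 //= ler_pdivrMr // mul1r lerDl ltW.
have qE x : 0 < x -> x / (x + s) * (x + s) = x 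
  by move=> x0; rewrite divfK // gt_eqF // addr_gt0.
have [N1|?] := mixed_tie_compensated (leqnSn M) (q01 _ tM) (qE _ tM); last by right.
have [N2|?] := mixed_tie_compensated (leqnn M.+1) (q01 _ tM1) (qE _ tM1); last by right.
left; apply: (mixed_tie_Nash_interval (q1 := t M / (t M + s))
  (q2 := t M.+1 / (t M.+1 + s))) N1 N2; rewrite ?q01 //.
have x1 := addr_gt0 tM s0; have x2 := addr_gt0 tM1 s0; rewrite tS in x2 *.
(* In this form the odds visibly increase with [t], as [s] is positive. *)
have -> : t M / (t M + s) = 1 - s / (t M + s) by field; rewrite gt_eqF.
have -> : (t M + (X - Y)) / (t M + (X - Y) + s) = 1 - s / (t M + (X - Y) + s).
  by field; rewrite gt_eqF.
by rewrite ltrD2l ltrN2 ltr_pM2l // ltf_pV2 // ltrD2r ltrDl subr_gt0.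
Qed.

End MixedTie.

Lemma exists_min_in (I : finType) (P : pred I) (f : I -> R) i0 : P i0 ->
  exists2 i, P i & forall j, P j -> f i <= f j.
Proof. by move=> Pi0; case: (Order.TotalTheory.arg_minP f Pi0) => i Pi le; exists i. Qed.

(* Moving from [a] to [a'], take the first point where some action [c] catches up
   with the strict best reply [b] to [a]. *)
Lemma crossing_tie a a' b c0 : (forall c, c != b -> u2 a c < u2 a b) ->
  u2 a' b < u2 a' c0 ->
  exists2 p, 0 < p < 1 & exists c, tie (mix p (pure R a) (pure R a')) b c.
Proof.
move=> best lt0; pose x c := u2 a b - u2 a c; pose y c := u2 a' c - u2 a' b.
have x0 c : c != b -> 0 < x c by move=> /best; rewrite subr_gt0.
have nb c : 0 < y c -> c != b by apply: contraTneq => ->; rewrite /y subrr ltxx.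
have [|c yc minc] := @exists_min_in _ (fun c => 0 < y c) (fun c => x c / (x c + y c)) c0.
  by rewrite subr_gt0.
set r := x c / (x c + y c) in minc.
have xc := x0 c (nb c yc); have xyc : 0 < x c + y c by rewrite addr_gt0.
have rE : r * (x c + y c) = x c by rewrite divfK ?gt_eqF.
have r0 : 0 < r by rewrite divr_gt0.
have r1 : r < 1 by rewrite ltr_pdivrMr // mul1r ltrDl.
(* [r] is the weight of [a'], whereas [mix] takes that of [a]. *)
exists (1 - r); first by lra.
exists c; split=> [||e|].
- by apply: is_dist_mix; [lra | exact: is_dist_pure | exact: is_dist_pure].
- by rewrite eq_sym nb.
- rewrite !eu_mix1 !eu_pure.
  suff : r * (x e + y e) <= x e by rewrite /x /y; lra.
  (* Actions that beat [b] at [a'] catch up no earlier than [c], by minimality of [r]; the others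
     never overtake [b]. *)
  have [ye|ye] := ltP 0 (y e).
    have xye := addr_gt0 (x0 e (nb e ye)) ye.
    by rewrite -ler_pdivlMr //; exact: minc.
  have [->|/x0 xe] := eqVneq e b; first by rewrite /x /y !subrr; lra.
  have : r * y e <= 0 by rewrite mulr_ge0_le0 // ltW.
  have : r * x e <= x e by rewrite ler_piMl // ltW.
  by lra.
- rewrite !eu_mix1 !eu_pure; move: rE; rewrite /x /y; lra.
Qed.

(** Without a tie at a pure action, the best reply [b] to [a] is strict. Either another action
    overtakes it at some [a'], giving a tie in between, or player 2 plays [b] in every equilibrium,
    which contradicts [Y < X]. *)
Lemma exists_tie : (exists a b b', tie (pure R a) b b') \/
  exists a a' b b' p, [/\ a != a', 0 < p < 1 & tie (mix p (pure R a) (pure R a')) b b'].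
Proof.
have [?|noT] := pselect (exists a b b', tie (pure R a) b b'); [by left | right].
have [[d1 d2] [d1' d2']] := (stageNash_dist N, stageNash_dist N').
have [a _] := dist_supp_exists d1; have [b0 _] := dist_supp_exists d2.
have strict a0 b : (forall c, u2 a0 c <= u2 a0 b) -> forall c, c != b -> u2 a0 c < u2 a0 b.
  move=> best c cb; rewrite lt_neqAle best andbT; apply/eqP => E; apply: noT.
  exists a0, b, c; split; rewrite ?eu_pure //; first exact: is_dist_pure.
    by rewrite eq_sym.
  by move=> e; rewrite !eu_pure.
have [b _ bmax] := @exists_min_in _ predT (fun c => - u2 a c) b0 isT.
have best : forall c, u2 a c <= u2 a b by move=> c; rewrite -lerN2 bmax.
have [[a' [c lt]]|nlt] := pselect (exists a' c, u2 a' b < u2 a' c).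
  have [p p01 [b' T]] := crossing_tie (strict a b best) lt.
  exists a, a', b, b', p; split=> //.
  by apply/eqP => E; have := best c; rewrite E leNgt lt.
(* Now [b] is strictly dominant, so player 1 has a single equilibrium payoff. *)
have dom a0 c : c != b -> u2 a0 c < u2 a0 b.
  by apply: strict => e; rewrite leNgt; apply/negP => lt; apply: nlt; exists a0, e.
have only t1 t2 : stageNash MM u1 u2 t1 t2 -> t2 = pure R b.
  move=> Nt; have [e1 e2] := stageNash_dist Nt; have /stageNashP[_ _ _ br] := Nt.
  have ltb c : c != b -> eu u2 t1 (pure R c) < eu u2 t1 (pure R b).
    move=> cb; rewrite !eu_pure2; have [a0 ta0] := dist_supp_exists e1.
    rewrite (bigD1 a0) //= [ltRHS](bigD1 a0) //= ltr_leD ?ltr_pM2l ?dom //.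
    by apply: ler_sum => a1 _; apply: ler_wpM2l (ltW (dom _ _ cb)); case: e1.
  have le c : eu u2 t1 (pure R c) <= eu u2 t1 (pure R b).
    by have [->//|/ltb/ltW] := eqVneq c b.
  have Eb : eu u2 t1 t2 = eu u2 t1 (pure R b).
    by apply/eqP; rewrite eq_le br andbT; exact: eu_le_pure2.
  have supp c : 0 < t2 c -> c = b.
    rewrite eu_col in Eb; move=> /(dist_avg_max e2 le Eb) E.
    by apply/eqP; apply: contraT => /ltb; rewrite E ltxx.
  have z c : c != b -> t2 c = 0.
    move=> cb; apply/eqP; case: e2 => t0 _; rewrite eq_le t0 andbT leNgt.
    by apply/negP => /supp /eqP; apply/negP.
  apply/ffunP => c; rewrite ffunE; have [->|/z //] := eqVneq c b.
  by case: e2 => _; rewrite (bigD1 b) //= big1 ?addr0.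
(* Both equilibria face [b], so deviating from [s1'] to [s1] would gain [X - Y]. *)
have E2 := only _ _ N; have E2' := only _ _ N'.
case: N' => _ _ /(_ s1 d1) + _; rewrite E2' -E2; move: ltXY; rewrite E2' -E2.
by rewrite ltNge => /negP.
Qed.

Lemma suboptimal_root_lottery p1 p2 a1' :
  is_dist p1 -> is_dist p2 -> eu u1 p1 p2 < eu u1 (pure R a1') p2 ->
  (forall a2, eu u2 p1 (pure R a2) <= eu u2 p1 p2) ->
  suboptimal_root MM u1 u2 payoff.
Proof.
move=> d1 d2 lt br.
suff [I|//] : attains_interval \/ suboptimal_root MM u1 u2 payoff.
  exact: attains_interval_suboptimal I d1 d2 lt br.
have [[a [b [b' T]]]|[a [a' [b [b' [p [aa' p01 T]]]]]]] := exists_tie.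
  by left; exact: pure_tie_attains_interval T.
have [B _ bnd] := payoff_bound u1.
have [M leM] : exists M : nat, 2 * B + 1 <= (X - Y) *+ M.
  by apply: exists_multiple; rewrite subr_gt0.
exact: mixed_tie_attains_interval aa' T bnd leM.
Qed.

End Lottery.

(** * Symmetry of the fully mixed regime *)

Section Swapping.
Set Implicit Arguments.
Unset Strict Implicit.
Variables (R : realType) (A1 A2 : finType).

Lemma spe_payoff_swap (u1 u2 : A1 -> A2 -> R) n x y : spe_payoff MM u1 u2 n x y ->
  spe_payoff MM (fun a2 a1 => u2 a1 a2) (fun a2 a1 => u1 a1 a2) n y x.
Proof.
elim=> [|{}n p1 p2 w1 w2 _ IH N]; first exact: spe_payoff0.
rewrite -[eu (boost u1 w1) _ _]eu_swap -[eu (boost u2 w2) _ _]eu_swap.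
apply: (spe_payoffS (w1 := fun a2 a1 => w2 a1 a2) (w2 := fun a2 a1 => w1 a1 a2)) => //.
exact: stageNash_swap N.
Qed.

Lemma suboptimal_root_swap (u1 u2 : A1 -> A2 -> R) :
  suboptimal_root MM u1 u2 (spe_payoff MM u1 u2) ->
  suboptimal_root MM (fun a2 a1 => u2 a1 a2) (fun a2 a1 => u1 a1 a2)
    (spe_payoff MM (fun a2 a1 => u2 a1 a2) (fun a2 a1 => u1 a1 a2)).
Proof.
move=> [n [p1 [p2 [w1 [w2 [H N nN]]]]]].
exists n, p2, p1, (fun a2 a1 => w2 a1 a2), (fun a2 a1 => w1 a1 a2); split.
- by move=> a2 a1; exact: spe_payoff_swap.
- exact: stageNash_swap N.
- by move=> N'; apply: nN; exact: stageNash_swap N'.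
Qed.

End Swapping.

(** * Sufficiency of [C_mm] and comparison with [C_mp] *)

Section CharacterizationMM.
Set Implicit Arguments.
Unset Strict Implicit.
Variables (R : realType) (A1 A2 : finType) (u1 u2 : A1 -> A2 -> R).

Lemma C_mm_GLS (hA1 : (0 < #|A1|)%N) (hA2 : (0 < #|A2|)%N) :
  C_mm u1 u2 -> in_GLS MM u1 u2.
Proof.
move=> C; apply: suboptimal_root_GLS => //; case: C.
- move=> [g1 g2 [p1 [p2 [d1 d2 nN]]]].
  have [b1 [b2 nN']] := nonNash_pure MM (r := MM) d1 d2 nN.
  exact: suboptimal_root_gt1 g1 g2 nN'.
- move=> [g1 /card_is1_const[v cV] [p1 [p2 [a1' [d1 d2 lt br]]]]].
  have [X [Y [[s1 [s2 [N EX]]] [s1' [s2' [N' EY]]] ltXY]]] := card_gt1_lt g1.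
  rewrite EX EY in ltXY.
  apply: (suboptimal_root_lottery N N' cV ltXY d1 d2 lt) => a2.
  by apply: br; exact: is_dist_pure.
(* The lottery argument is applied with the players exchanged, and the resulting root is exchanged
   back. *)
- move=> [/card_is1_const[v cV] g2 [p1 [p2 [a2' [d1 d2 lt br]]]]].
  have [X [Y [[s1 [s2 [N EX]]] [s1' [s2' [N' EY]]] ltXY]]] := card_gt1_lt g2.
  rewrite EX EY -(eu_swap u2 s1) -(eu_swap u2 s1') in ltXY.
  have cV' y : V2 MM (fun a2 a1 => u2 a1 a2) (fun a2 a1 => u1 a1 a2) y -> y = v.
    move=> [t2 [t1 [Nt ->]]]; rewrite eu_swap; apply: cV.
    by exists t1, t2; split=> //; exact: stageNash_swap Nt.
  rewrite -(eu_swap u2 p1 p2) -(eu_swap u2 p1 (pure R a2')) in lt.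
  have br' a1 : eu (fun a2 a1 => u1 a1 a2) p2 (pure R a1) <= eu (fun a2 a1 => u1 a1 a2) p2 p1.
    rewrite (eu_swap u1 p1 p2) (eu_swap u1 (pure R a1) p2).
    by apply: br; exact: is_dist_pure.
  have H := suboptimal_root_lottery (stageNash_swap N) (stageNash_swap N') cV' ltXY
    d2 d1 lt br'.
  exact: (@suboptimal_root_swap R A2 A1 (fun a2 a1 => u2 a1 a2) (fun a2 a1 => u1 a1 a2) H).
Qed.

Lemma C_mm_nonNash : C_mm u1 u2 ->
  exists p1 p2, [/\ is_dist p1, is_dist p2 & ~ stageNash MM u1 u2 p1 p2].
Proof.
case=> [[_ _ H]|[_ _ [p1 [p2 [a1' [d1 d2 lt _]]]]]|[_ _ [p1 [p2 [a2' [d1 d2 lt _]]]]]] //.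
  by exists p1, p2; split=> // /stageNashP[_ _ /(_ a1') + _]; rewrite leNgt lt.
by exists p1, p2; split=> // /stageNashP[_ _ _ /(_ a2')]; rewrite leNgt lt.
Qed.

(** A non-equilibrium of the mixed regime yields a pure one, and a pure profile is available in [MP]
    too. *)
Lemma C_mm_C_mp : card_gt1 (V1 MP u1 u2) -> card_gt1 (V2 MP u1 u2) ->
  C_mm u1 u2 -> C_mp u1 u2.
Proof.
move=> g1 g2 /C_mm_nonNash[p1 [p2 [d1 d2 nN]]].
have [a1 [a2 nN']] := nonNash_pure MP (r := MM) d1 d2 nN.
by apply: Or31; split=> //; exists (pure R a1), a2; split=> //; exact: is_dist_pure.
Qed.

Lemma card_cases (V : R -> Prop) : [\/ card_is0 V, card_is1 V | card_gt1 V].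
Proof.
have [g|[v cV]] := card_gt1_or_const V; first exact: Or33.
have [ne|/forallNP e] := pselect (exists x, V x); last exact: Or31.
by apply: Or32; exact: const_nonempty_card_is1 cV ne.
Qed.

Lemma card_is0_not_gt1 (V : R -> Prop) : card_is0 V -> ~ card_gt1 V.
Proof. by move=> V0 [x [_ [Vx _ _]]]; exact: V0 Vx. Qed.

Lemma card_is1_not_gt1 (V : R -> Prop) : card_is1 V -> ~ card_gt1 V.
Proof. by move=> /card_is1_const[v cV]; exact: const_card_gt1F cV. Qed.

Lemma card_is0_V1_V2 r : card_is0 (V1 r u1 u2) <-> card_is0 (V2 r u1 u2).
Proof.
have [H12 H21] := V1_V2_nonempty r u1 u2.
split=> V0 x Vx.
  by have [|y] := H21; [exists x | exact: V0].
by have [|y] := H12; [exists x | exact: V0].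
Qed.

End CharacterizationMM.

Theorem mainTheorem15 (R : realType) (A1 A2 : finType)
    (hA1 : (0 < #|A1|)%N) (hA2 : (0 < #|A2|)%N)
    (u1 u2 : A1 -> A2 -> R) :
  (~ in_GLS MP u1 u2 /\ in_GLS MM u1 u2) <->
  [\/ [/\ card_is0 (V1 MP u1 u2), card_is0 (V2 MP u1 u2) & C_mm u1 u2],
      [/\ card_is1 (V1 MP u1 u2), card_is1 (V2 MP u1 u2) & C_mm u1 u2],
      [/\ card_gt1 (V1 MP u1 u2), card_is1 (V2 MP u1 u2), ~ C_mp u1 u2 & C_mm u1 u2] |
      [/\ card_is1 (V1 MP u1 u2), card_gt1 (V2 MP u1 u2), ~ C_mp u1 u2 & C_mm u1 u2]].
Proof.
(* This excludes [C_mp] in the first two cases, where neither value set has two elements. *)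
have gt1_C_mp : C_mp u1 u2 -> card_gt1 (V1 MP u1 u2) \/ card_gt1 (V2 MP u1 u2).
  by case=> -[]; [left | left | right].
split=> [[nGLS /GLS_C_mm Cmm]|].
  have nC : ~ C_mp u1 u2 by move=> /(C_mp_GLS hA1 hA2).
  have V12 := card_is0_V1_V2 u1 u2 MP.
  have ne (V : R -> Prop) : card_is0 V -> card_is1 V \/ card_gt1 V -> False.
    by move=> V0 [[x [Vx _]]|[x [_ [Vx _ _]]]]; exact: V0 Vx.
  have [c1|c1|c1] := card_cases (V1 MP u1 u2); have [c2|c2|c2] := card_cases (V2 MP u1 u2).
  - exact: Or41.
  - by case: (ne _ (V12.1 c1)); left.
  - by case: (ne _ (V12.1 c1)); right.
  - by case: (ne _ (V12.2 c2)); left.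
  - exact: Or42.
  - exact: Or44.
  - by case: (ne _ (V12.2 c2)); right.
  - exact: Or43.
  - by case: nC; exact: C_mm_C_mp.
case=> [[c1 c2 C]|[c1 c2 C]|[_ _ nC C]|[_ _ nC C]];
  split; try exact: C_mm_GLS; move=> /GLS_C_mp // /gt1_C_mp[].
- exact: card_is0_not_gt1.
- exact: card_is0_not_gt1.
- exact: card_is1_not_gt1.
- exact: card_is1_not_gt1.
Qed.
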